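(* Let $K$ be a field, let $G$ be a simple graph on the vertex set $[n]=\{1,\ldots,n\}$, let $\bar G$ be its complement, and let $I=I(\bar G)\subset S=K[x_1,\ldots,x_n]$ be the edge ideal of $\bar G$. Assume $I\neq 0$. Then for every integer $p>0$ the following are equivalent: (a) $I$ satisfies the $N_{2,p}$-property; (b) every induced cycle in $G$ of length $>3$ has length $\geq p+3$. In particular, $$\mathrm{index}(I)=\inf\{\,|C|-3 : C \text{ is an induced cycle in } G \text{ of length} >3\,\},$$ where $|C|$ denotes the length of $C$ and the infimum of the empty set is $\infty$.
   Context: $S$ has the standard grading. The graded Betti numbers of a finitely generated graded $S$-module $M$ are $\beta^K_{i,j}(M)=\dim_K\mathrm{Tor}^S_i(K,M)_j$. The edge ideal of a simple graph $H$ on $[n]$ is $I(H)=(x_ix_j : \{i,j\}\in E(H))\subset S$. The complement $\bar G$ has the same vertex set as $G$, and its edges are the pairs $\{u,v\}$ with $u\ne v$ and $\{u,v\}\notin E(G)$. An induced cycle in $G$ is an induced subgraph of $G$ that is a cycle; its length is its number of vertices. A non-zero homogeneous ideal $I\subset S$ satisfies the $N_{d,p}$-property ($p>0$ an integer) if $\beta^K_{i,i+j}(I)=0$ for all $i<p$ and all $j>d$. With $d=\mathrm{indeg}(I)=\inf\{i : I_i\neq 0\}$ the initial degree of $I$, the (Green–Lazarsfeld) index of $I$ is $\mathrm{index}(I)=\sup\{p : I \text{ satisfies the } N_{d,p}\text{-property}\}\in\{1,2,\ldots\}\cup\{\infty\}$ whenever $I$ satisfies $N_{d,1}$ (which holds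 for non-zero edge ideals, where $d=2$). *)

(* Defs.v *)
From HB Require Import structures.
From mathcomp Require Import all_boot all_order all_algebra.
From mathcomp Require Import mpoly.
From mathcomp Require Import boolp classical_sets constructive_ereal ring.
From mathcomp Require Import finset.

Set Implicit Arguments.
Unset Strict Implicit.
Unset Printing Implicit Defensive.

Import Order.TTheory GRing.Theory Num.Theory.

Local Open Scope ring_scope.

(* Extended natural numbers are taken inside \bar int.  The default values of *)
(* supremum and infimum give sup(empty) = 0 and inf(empty) = +oo.             *)

Definition esup (A : set nat) : \bar int :=
  supremum 0%E [set (m%:Z)%:E | m in A]%classic.

Definition einf (A : set nat) : \bar int :=
  infimum +oo%E [set (m%:Z)%:E | m in A]%classic.

Section Dimension.
Variables (K : fieldType) (V : lmodType K).

Definition free_modulo (B : set V) m (v : 'I_m -> V) : Prop :=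
  forall c : 'I_m -> K, B (\sum_(i < m) c i *: v i) -> forall i, c i = 0.

(* dim_K (Z / B), for subspaces B <= Z of V. *)
Definition dim_quotient (Z B : set V) : \bar int :=
  esup [set m | exists2 v : 'I_m -> V,
                  (forall i, Z (v i)) & free_modulo B v]%classic.

End Dimension.

Section GradedFreeResolution.
Variables (K : fieldType) (n : nat).
Local Notation S := {mpoly K[n]}.

(* The map S^A -> S^B sending the basis vector e_a to \sum_b d a b e_b. *)
Definition free_map (A B : finType) (d : A -> B -> S) (v : {ffun A -> S}) :
  {ffun B -> S} := [ffun b => \sum_a v a * d a b].

(* The map S^B -> K = S / (x_1, .., x_n) sending e_b to eps b. *)
Definition free_aug (B : finType) (eps : B -> K) (v : {ffun B -> S}) : K :=
  \sum_b (v b)@_0%MM * eps b.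

(* f is homogeneous of degree j - e, i.e. f belongs to S(-e)_j. *)
Definition homog_shift (e j : nat) (f : S) : bool :=
  if (e <= j)%N then f \is (j - e)%N.-homog else f == 0.

(* An exact sequence  .. -> F_2 -> F_1 -> F_0 -> K -> 0  of graded S-modules  *)
(* and maps of degree 0, F_i being free with the finite homogeneous basis     *)
(* fbasis i, and K being concentrated in degree 0.                            *)
Record graded_free_resolution := GradedFreeResolution {
  fbasis : nat -> finType;
  fdeg : forall i, fbasis i -> nat;
  fdiff : forall i, fbasis i.+1 -> fbasis i -> S;
  faug : fbasis 0 -> K;
  fdiff_homog : forall i (a : fbasis i.+1) (b : fbasis i),
    homog_shift (fdeg b) (fdeg a) (fdiff a b);
  faug_homog : forall b : fbasis 0, faug b != 0 -> fdeg b = 0%N;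
  faug_surj : exists b : fbasis 0, faug b != 0;
  fexact0 : forall v : {ffun fbasis 0 -> S},
    free_aug faug v = 0 <-> exists w, v = free_map (@fdiff 0) w;
  fexactS : forall i (v : {ffun fbasis i.+1 -> S}),
    free_map (@fdiff i) v = 0 <-> exists w, v = free_map (@fdiff i.+1) w
}.

(* As F_i is free, F_i (x)_S I is the submodule of S^(fbasis F i) of the      *)
(* vectors with entries in I; tensor_part F I i j is its component of degree  *)
(* j.                                                                         *)
Definition tensor_part (F : graded_free_resolution) (I : set S) (i j : nat) :
  set {ffun fbasis F i -> S} :=
  [set v | forall b, I (v b) /\ homog_shift (fdeg b) j (v b)]%classic.

Arguments tensor_part F I i j : clear implicits.

Definition tensor_kernel (F : graded_free_resolution) (i : nat) :
  set {ffun fbasis F i -> S} :=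
  match i with
  | 0 => [set: _]%classic
  | i'.+1 => [set v | free_map (@fdiff F i') v = 0]%classic
  end.

Arguments tensor_kernel F i : clear implicits.

Definition tensor_cycles (F : graded_free_resolution) (I : set S) (i j : nat) :
  set {ffun fbasis F i -> S} :=
  (tensor_part F I i j `&` tensor_kernel F i)%classic.

Arguments tensor_cycles F I i j : clear implicits.

Definition tensor_boundaries (F : graded_free_resolution) (I : set S) (i j : nat) :
  set {ffun fbasis F i -> S} :=
  [set free_map (@fdiff F i) w | w in tensor_part F I i.+1 j]%classic.

Arguments tensor_boundaries F I i j : clear implicits.

(* dim_K of H_i(F (x)_S I)_j, i.e. of Tor^S_i(K, I)_j computed from F. *)
Definition tor_dim (F : graded_free_resolution) (I : set S) (i j : nat) :
  \bar int :=
  dim_quotient (tensor_cycles F I i j) (tensor_boundaries F I i j).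

End GradedFreeResolution.

Section Koszul.
Variables (K : fieldType) (n : nat).
Local Notation S := {mpoly K[n]}.
Implicit Types (A B : {set 'I_n}) (m : 'X_{1..n}) (u : {set 'I_n} -> S).

Definition koszul_sign (k : 'I_n) A : S :=
  (-1) ^+ #|[set l in A | (l < k)%N]|.

Definition koszul_coef A B : S :=
  \sum_(k in A | B == A :\ k) koszul_sign k A * 'X_k.

Definition koszul_basis (i : nat) : finType := {A : {set 'I_n} | #|A| == i}.

Definition koszul_deg i (b : koszul_basis i) : nat := i.

Definition koszul_diff i (a : koszul_basis i.+1) (b : koszul_basis i) : S :=
  koszul_coef (val a) (val b).

Definition koszul_aug (b : koszul_basis 0) : K := 1.

Lemma koszul_sign_homog k A : koszul_sign k A \is 0.-homog.
Proof.
rewrite /koszul_sign -signr_odd; case: odd; rewrite ?expr1 ?expr0 ?rpredN;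
exact: dhomog1.
Qed.

Lemma koszul_diff_homog i (a : koszul_basis i.+1) (b : koszul_basis i) :
  homog_shift (koszul_deg b) (koszul_deg a) (koszul_diff a b).
Proof.
rewrite /homog_shift /koszul_deg leqnSn subSnn; apply: rpred_sum => k _.
rewrite -[1%N]add0n; apply: dhomogM; first exact: koszul_sign_homog.
by rewrite dhomogX; apply/eqP/mdeg1.
Qed.

Lemma koszul_aug_homog (b : koszul_basis 0) :
  koszul_aug b != 0 -> koszul_deg b = 0%N.
Proof. by []. Qed.

Lemma koszul_aug_surj : exists b : koszul_basis 0, koszul_aug b != 0.
Proof.
have h : #|(set0 : {set 'I_n})| == 0%N by rewrite cards0.
by exists (exist _ set0 h); rewrite /koszul_aug oner_neq0.
Qed.

Let ext i (v : {ffun koszul_basis i -> S}) A : S :=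
  if insub A is Some a then v a else 0.

Let D u B : S := \sum_(k | k \notin B) u (k |: B) * koszul_sign k (k |: B) * 'X_k.

Let extE i (v : {ffun koszul_basis i -> S}) (a : koszul_basis i) :
  ext v (val a) = v a.
Proof. by rewrite /ext valK. Qed.

Let ext0 i (v : {ffun koszul_basis i -> S}) A : #|A| != i -> ext v A = 0.
Proof. by move=> h; rewrite /ext insubN. Qed.

Let free_mapE i (v : {ffun koszul_basis i.+1 -> S}) (b : koszul_basis i) :
  free_map (@koszul_diff i) v b = D (ext v) (val b).
Proof.
rewrite ffunE.
transitivity (\sum_(A : {set 'I_n} | #|A| == i.+1) ext v A * koszul_coef A (val b)).
  rewrite [RHS](reindex_omap (val : koszul_basis i.+1 -> _) insub); last first.
    by move=> A hA; rewrite insubT.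
  apply: eq_big => [a|a _]; last by rewrite extE.
  by rewrite valK eqxx andbT; apply/esym/(valP a).
transitivity (\sum_(A : {set 'I_n}) ext v A * koszul_coef A (val b)).
  rewrite [RHS](bigID (fun A : {set 'I_n} => #|A| == i.+1)) /=.
  by rewrite [X in _ = _ + X]big1 ?addr0 // => A h; rewrite ext0 ?mul0r.
rewrite /koszul_coef /D.
under eq_bigr => A _ do rewrite mulr_sumr.
rewrite (exchange_big_dep predT) //= [RHS]big_mkcond /=.
apply: eq_bigr => k _.
case: ifP => kb.
  rewrite (big_pred1 (k |: val b)) ?mulrA // => A /=.
  apply/andP/eqP => [[kA /eqP ->]|->]; first by rewrite setD1K.
  by rewrite setU11 setU1K.
apply: big1 => A /andP[kA /eqP h].
by rewrite h !inE eqxx in kb.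
Qed.

Let D_ext i (v : {ffun koszul_basis i.+1 -> S}) :
  free_map (@koszul_diff i) v = 0 -> forall B, D (ext v) B = 0.
Proof.
move=> h B; case: (boolP (#|B| == i)) => hB.
  by rewrite -[B]/(val (exist _ B hB : koszul_basis i)) -free_mapE h ffunE.
rewrite /D big1 // => k kB; rewrite ext0 ?mul0r //.
by rewrite cardsU1 kB add1n eqSS.
Qed.

Let signSS (k l : 'I_n) B : k \notin B -> l \notin B -> (k < l)%N ->
  koszul_sign l (l |: (k |: B)) * koszul_sign k (k |: B) =
  - (koszul_sign k (k |: (l |: B)) * koszul_sign l (l |: B)).
Proof.
move=> kB lB kl; rewrite /koszul_sign -!exprD.
set a := #|[set _ in l |: (k |: B) | _]|; set b := #|[set _ in k |: B | _]|.
set c := #|[set _ in _ | _]|; set d := #|[set _ in _ | _]|.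
have -> : b = c.
  apply: eq_card => j; rewrite !inE; case: (eqVneq j l) => [->|] //=.
  by rewrite ltnNge (ltnW kl) !andbF.
have -> : a = d.+1.
  rewrite /a /d -add1n; rewrite -[1%N]/(nat_of_bool true).
  have -> : true = (k \notin [set x in l |: B | (x < l)%N]).
    by rewrite !inE (negbTE kB) orbF; case: eqVneq kl => // ->; rewrite ltnn.
  rewrite -cardsU1; apply: eq_card => j; rewrite !inE.
  by case: (eqVneq j k) => [->|]; rewrite ?kl ?orbT //=; case: (j == l).
by rewrite addnC addnS exprS mulN1r.
Qed.

Let DD u B : D (D u) B = 0.
Proof.
pose f k l := u (l |: (k |: B)) * koszul_sign l (l |: (k |: B)) * 'X_l *
  koszul_sign k (k |: B) * 'X_k : S.
have -> : D (D u) B = \sum_(k | k \notin B) \sum_(l | l \notin k |: B) f k l.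
  by apply: eq_bigr => k _; rewrite !mulr_suml.
pose P (k l : 'I_n) := [&& k \notin B, l \notin B & (k < l)%N].
have -> : \sum_(k | k \notin B) \sum_(l | l \notin k |: B) f k l =
  \sum_k \sum_(l | P k l) f k l + \sum_k \sum_(l | P l k) f k l.
  rewrite -big_split big_mkcond /=; apply: eq_bigr => k _.
  rewrite /P; case: ifP => kB /=; last first.
    rewrite !big_pred0 ?addr0 // => l; rewrite /= ?andbF //.
  rewrite (bigID (fun l : 'I_n => (k < l)%N)) /=; congr (_ + _);
    apply: eq_bigl => l; rewrite !inE negb_or; last first.
    rewrite -leqNgt leq_eqVlt (inj_eq val_inj).
    by case: eqVneq => //= ->; rewrite ltnn andbF.
  by case: ltnP => kl; rewrite ?andbF ?andbT //=; case: eqVneq kl => // ->; rewrite ltnn.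
rewrite [X in _ + X](exchange_big_dep predT) //= -big_split big1 //= => k _.
rewrite -big_split big1 //= => l /and3P[kB lB kl].
have e : l |: (k |: B) = k |: (l |: B) by rewrite setUCA.
rewrite /f -e.
have := signSS kB lB kl; rewrite -e => h.
transitivity (u (l |: (k |: B)) * ('X_l * 'X_k) *
  (koszul_sign l (l |: (k |: B)) * koszul_sign k (k |: B) +
   koszul_sign k (l |: (k |: B)) * koszul_sign l (l |: B))); first by ring.
by rewrite h addNr mulr0.
Qed.


Let mcoeff_mulU (p : S) (k : 'I_n) m :
  (p * 'X_k)@_m = if (0 < m k)%N then p@_(m - U_(k))%MM else 0.
Proof.
case: ifP => h; last first.
  apply/memN_msupp_eq0/negP => hm.
  have := msuppM_le hm; case/allpairsP => -[m1 m2] /= [_].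
  rewrite msuppX inE => /eqP -> e; move: h; rewrite e mnmDE mnm1E eqxx.
  by rewrite addn1.
have e : m = (U_(k) + (m - U_(k)))%MM.
  rewrite addmC submK //; apply/mnm_lepP => l; rewrite mnm1E.
  by case: eqVneq => // <-.
by rewrite {1}e mcoeffMX.
Qed.

(* The contraction of the Koszul complex: x^m e_A is sent to                  *)
(* x^(m - U_k) e_(k |: A), k being the least element of A or supp m, if k is  *)
(* not in A, and to 0 otherwise.                                              *)
Let least (k : 'I_n) A m : bool :=
  (k \in A) && [forall l : 'I_n, (l < k)%N ==> (l \notin A) && (m l == 0%N)].

Let h u A : S := \sum_(k | k \in A) \sum_(m <- msupp (u (A :\ k)) |
    (0 < m k)%N && least k A (m - U_(k))%MM) (u (A :\ k))@_m *: 'X_[m - U_(k)].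

Let mcoeff_h u A m :
  (h u A)@_m = \sum_(k | least k A m) (u (A :\ k))@_(m + U_(k))%MM.
Proof.
rewrite /h raddf_sum /= [RHS]big_mkcond [LHS]big_mkcond /=; apply: eq_bigr => k _.
case: ifP => kA; last by rewrite /least kA.
rewrite raddf_sum /=.
have sub m' : (0 < m' k)%N -> (m' - U_(k))%MM = m -> m' = (m + U_(k))%MM.
  move=> hm <-; rewrite submK //; apply/mnm_lepP => l; rewrite mnm1E.
  by case: eqVneq => // <-.
transitivity (\sum_(m' <- msupp (u (A :\ k)) | m' == (m + U_(k))%MM)
    if least k A m then (u (A :\ k))@_(m + U_(k))%MM else 0).
  rewrite big_mkcond [RHS]big_mkcond /=; apply: eq_bigr => m' _.
  case: (eqVneq m' (m + U_(k))%MM) => [->|ne].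
    rewrite addmK mnmDE mnm1E eqxx addn1 /=; case: ifP => // _.
    by rewrite mcoeffZ mcoeffX eqxx mulr1.
  case: ifP => // /andP[hk _]; rewrite mcoeffZ mcoeffX.
  by case: eqVneq => [/(sub _ hk)/eqP|]; rewrite ?(negbTE ne) // mulr0.
case: (boolP ((m + U_(k))%MM \in msupp (u (A :\ k)))) => hm.
  by rewrite -big_filter filter_pred1_uniq ?big_seq1 // msupp_uniq.
rewrite big_seq_cond big1; first by rewrite (memN_msupp_eq0 hm) if_same.
by move=> m' /andP[hm' /eqP e]; rewrite -e hm' in hm.
Qed.

Let least_uniq k0 k B m l : (k0 \in B) || (0 < m k0)%N ->
  (forall j : 'I_n, (j < k0)%N -> j \notin B /\ m j = 0%N) ->
  l \notin B -> (0 < m l)%N ->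
  least k (l |: B) (m - U_(l))%MM = (k == k0) && (k0 \in l |: B).
Proof.
move=> hk0 hlt lB ml; apply/andP/andP => [[kB /forallP hk]|[/eqP -> hkB]].
  suff ek : k = k0 by rewrite -ek.
  apply: ord_inj; apply/eqP; rewrite eqn_leq.
  apply/andP; split; rewrite leqNgt; apply/negP => lt.
  - have := hk k0; rewrite lt /= !inE => /andP[/norP[ne k0B]].
    rewrite mnmBE mnm1E [l == _]eq_sym (negbTE ne) subn0 => /eqP e.
    by rewrite (negbTE k0B) e in hk0.
  - have [k1 k2] := hlt _ lt; move: kB; rewrite !inE (negbTE k1) orbF.
    by move=> /eqP e; rewrite -e k2 in ml.
split=> //; apply/forallP => j; apply/implyP => /hlt[jB mj].
rewrite mnmBE mj sub0n eqxx andbT !inE (negbTE jB) orbF.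
by apply/eqP => e; rewrite -e mj in ml.
Qed.

Let DhE u B : (forall A, D u A = 0) -> (B = set0 -> (u B)@_0%MM = 0) ->
  D (h u) B = u B.
Proof.
move=> Du u0; apply/mpolyP => m.
have mcD v A m' : (D v A)@_m' = \sum_(l | (l \notin A) && (0 < m' l)%N)
    (-1) ^+ #|[set j in l |: A | (j < l)%N]| * (v (l |: A))@_(m' - U_(l))%MM.
  rewrite /D raddf_sum /= big_mkcondr; apply: eq_bigr => l _.
  rewrite mcoeff_mulU; case: ifP => // _; rewrite /koszul_sign mulrC.
  by rewrite -signr_odd -[in RHS]signr_odd; case: odd;
    rewrite ?expr1 ?expr0 ?mulN1r ?mul1r ?mcoeffN.
have [T0|/set0Pn[i iT]] := eqVneq [set l | (l \in B) || (0 < m l)%N] set0.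
  have T l : ((l \in B) || (0 < m l)%N) = false.
    by have /setP/(_ l) := T0; rewrite !inE.
  have B0 : B = set0.
    by apply/setP => l; rewrite inE; have := T l; case: (l \in B).
  have m0 : m = 0%MM.
    by apply/mnmP => l; rewrite mnm0E; have := T l; case: (m l) => [|q] //; rewrite orbT.
  rewrite m0 u0 // mcD big_pred0 // => l.
  by rewrite mnm0E ltnn andbF.
rewrite inE in iT.
case: (@arg_minnP _ i (fun l => (l \in B) || (0 < m l)%N) (@nat_of_ord n) iT).
move=> k0 hk0 kmin {iT i}.
have hlt (j : 'I_n) : (j < k0)%N -> j \notin B /\ m j = 0%N.
  move=> lt; have := kmin j; case: (j \in B) => /=.
    by move=> /(_ isT); rewrite leqNgt lt.
  by case: (m j) => // q /(_ isT); rewrite leqNgt lt.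
rewrite mcD.
transitivity (\sum_(l | (l \notin B) && (0 < m l)%N)
   (-1) ^+ #|[set j in l |: B | (j < l)%N]| *
   (if k0 \in l |: B then (u ((l |: B) :\ k0))@_(m - U_(l) + U_(k0))%MM else 0)).
  apply: eq_bigr => l /andP[lB ml]; congr (_ * _); rewrite mcoeff_h.
  case: ifP => hB.
    by rewrite (big_pred1 k0) // => k; rewrite /= (least_uniq k hk0 hlt lB ml) hB andbT.
  by rewrite big_pred0 // => k; rewrite (least_uniq k hk0 hlt lB ml) hB andbF.
have sgn0 A : (forall j, j \in A -> (k0 <= j)%N) ->
    (-1) ^+ #|[set j in A | (j < k0)%N]| = 1 :> K.
  move=> hA; rewrite (_ : [set _ in _ | _] = set0) ?cards0 //.
  apply/setP => j; rewrite !inE; apply/negbTE/negP => /andP[/hA].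
  by rewrite leqNgt => /negP.
have Bmin j : j \in B -> (k0 <= j)%N.
  by move=> jB; apply: kmin; rewrite jB.
have subU l m' : (0 < m' l)%N -> (m' - U_(l) + U_(l))%MM = m'.
  move=> hl; rewrite submK //; apply/mnm_lepP => j; rewrite mnm1E.
  by case: eqVneq => // <-.
case: (boolP (k0 \in B)) => k0B; last first.
  have mk0 : (0 < m k0)%N by rewrite (negbTE k0B) in hk0.
  rewrite (bigD1 k0) /=; last by rewrite k0B.
  rewrite sgn0; last by move=> j; rewrite !inE => /orP[/eqP ->|/Bmin].
  rewrite setU11 setU1K // subU // mul1r big1 ?addr0 // => l.
  move=> /andP[/andP[_ _] ne]; rewrite !inE (negbTE k0B) orbF eq_sym.
  by rewrite (negbTE ne) mulr0.
have := congr1 (mcoeff (m + U_(k0))%MM) (Du (B :\ k0)); rewrite mcD mcoeff0.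
rewrite (bigD1 k0) /=; last by rewrite !inE eqxx mnmDE mnm1E eqxx addn1.
rewrite setD1K // sgn0 // mul1r addmK => /eqP; rewrite addr_eq0 => /eqP ->.
rewrite -sumrN.
apply: eq_big => [l|l /andP[lB ml]].
  rewrite !inE mnmDE mnm1E [k0 == l]eq_sym.
  by case: (eqVneq l k0) => [->|ne] /=; rewrite ?k0B ?andbF // addn0 andbT.
have ne : l != k0 by apply: contraNneq lB => ->.
have k0l : (k0 < l)%N.
  by rewrite ltn_neqAle kmin ?ml ?orbT // andbT eq_sym.
rewrite !inE k0B orbT.
have -> : (l |: B) :\ k0 = l |: (B :\ k0).
  apply/setP => j; rewrite !inE; case: (eqVneq j l) => [->|] //=.
  by rewrite ne.
have -> : (m - U_(l) + U_(k0))%MM = (m + U_(k0) - U_(l))%MM.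
  apply/mnmP => j; rewrite !(mnmDE, mnmBE, mnm1E).
  by case: (eqVneq l j) => [<-|]; rewrite ?subn0 // addnBAC.
rewrite -mulNr; congr (_ * _).
rewrite (_ : #|[set j in l |: B | _]| = #|[set j in l |: (B :\ k0) | (j < l)%N]|.+1).
  by rewrite exprS mulN1r.
rewrite (cardsD1 k0) !inE k0B orbT k0l add1n; congr _.+1.
apply: eq_card => j; rewrite !inE.
by case: (eqVneq j k0) => [->|] //=; rewrite eq_sym (negbTE ne).
Qed.

Let h_ext i (v : {ffun koszul_basis i -> S}) :
  exists w : {ffun koszul_basis i.+1 -> S}, ext w = h (ext v).
Proof.
exists [ffun a => h (ext v) (val a)]; apply: funext => A.
case: (boolP (#|A| == i.+1)) => hA.
  by rewrite -[A]/(val (exist _ A hA : koszul_basis i.+1)) extE ffunE.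
rewrite ext0 // /h big1 // => k kA; rewrite ext0 ?msupp0 ?big_nil //.
by move: hA; rewrite (cardsD1 k) kA add1n eqSS.
Qed.

Lemma koszul_exact0 (v : {ffun koszul_basis 0 -> S}) :
  free_aug koszul_aug v = 0 <-> exists w, v = free_map (@koszul_diff 0) w.
Proof.
have aug_ext : free_aug koszul_aug v = (ext v set0)@_0%MM.
  have h0 : #|(set0 : {set 'I_n})| == 0%N by rewrite cards0.
  have b0 (b : koszul_basis 0) : b = exist _ set0 h0.
    by apply: val_inj => /=; apply/eqP; rewrite -cards_eq0 (eqP (valP b)).
  rewrite -[set0]/(val (exist _ set0 h0 : koszul_basis 0)) extE.
  rewrite /free_aug (big_pred1 (exist _ set0 h0)) ?mulr1 // => b.
  by rewrite -(b0 b) /= eqxx.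
rewrite aug_ext; split=> [v0|[w ->]]; last first.
  rewrite /ext; case: insubP => [b _ _|]; last by rewrite mcoeff0.
  rewrite free_mapE /D raddf_sum big1 //= => k _.
  by rewrite mcoeff_mulU mnm0E ltnn.
have [w hw] := h_ext v; exists w; apply/ffunP => b; rewrite free_mapE hw DhE ?extE //.
  by move=> A; rewrite /D big1 // => k kA; rewrite ext0 ?mul0r // cardsU1 kA.
by move=> b0; rewrite -extE b0.
Qed.

Lemma koszul_exactS i (v : {ffun koszul_basis i.+1 -> S}) :
  free_map (@koszul_diff i) v = 0 <->
  exists w, v = free_map (@koszul_diff i.+1) w.
Proof.
split=> [/D_ext v0|[w ->]]; last first.
  apply/ffunP => b; rewrite free_mapE ffunE.
  rewrite -[RHS](DD (ext w) (val b)); congr (D _ _); apply: funext => A.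
  case: (boolP (#|A| == i.+1)) => hA.
    rewrite -[A]/(val (exist _ A hA : koszul_basis i.+1)) extE.
    exact: free_mapE.
  rewrite ext0 // /D big1 // => k kA; rewrite ext0 ?mul0r //.
  by rewrite cardsU1 kA add1n eqSS.
have [w hw] := h_ext v; exists w; apply/ffunP => b.
rewrite free_mapE hw DhE ?extE // => b0.
by have := valP b; rewrite b0 cards0.
Qed.

Definition koszul : graded_free_resolution K n :=
  GradedFreeResolution koszul_diff_homog koszul_aug_homog koszul_aug_surj
    koszul_exact0 koszul_exactS.

End Koszul.

Section Index.
Variables (K : fieldType) (n : nat).
Local Notation S := {mpoly K[n]}.

(* dim_K Tor^S_i(K, I)_j; Tor^S_i(K, I) does not depend on the resolution of  *)
(* K, and the Koszul resolution is used here.                                 *)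
Definition betti (I : set S) (i j : nat) : \bar int :=
  tor_dim (koszul K n) I i j.

(* To be used for p > 0 and a non-zero homogeneous ideal I. *)
Definition satisfies_N (I : set S) (d p : nat) : Prop :=
  forall i j : nat, (i < p)%N -> (d < j)%N -> betti I i (i + j) = 0%E.

Definition indeg (I : set S) : \bar int :=
  einf [set i | exists2 f : S, I f & f \is i.-homog /\ f != 0]%classic.

Definition gl_index (I : set S) : \bar int :=
  esup [set p | (0 < p)%N /\
                (exists2 d : nat, indeg I = (d%:Z)%:E & satisfies_N I d p)]%classic.

(* The ideal generated by the 'X_i * 'X_j with e i j. *)
Definition edge_ideal (e : rel 'I_n) : set S :=
  [set f | exists c : 'I_n -> 'I_n -> S,
             f = \sum_i \sum_(j | e i j) c i j * ('X_i * 'X_j)]%classic.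

End Index.

Arguments edge_ideal K {n} e.

Section Graph.
Variables (T : finType) (e : rel T).

Definition graph_compl : rel T := [rel u v | (u != v) && ~~ e u v].

(* The subgraph induced on C is a cycle, s listing its vertices in order. *)
Definition induced_cycle (C : {set T}) : Prop :=
  exists s : seq T, [/\ uniq s, (2 < size s)%N, C =i s &
    {in C &, forall u v, e u v = (v == next s u) || (u == next s v)}].

End Graph.

(* Main.v *)
(** Write I for the edge ideal of the complement of G.  In multidegree M the
    Koszul complex of I has the basis e_A with x^(M - 1_A) in I.  Indexing it by
    the complements F of A in the support of M turns it into a complex of relative
    cochains of a full simplex modulo the faces F such that F together with
    {k | M_k >= 2} is a clique of G.  If some M_k >= 2, these faces form a cone with
    apex k and nothing survives.  If M is the indicator of W, what is left is the
    reduced cohomology of the clique complex of G[W], so that Tor_i(K, I) in total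
    degree i + j is the sum over |W| = i + j of its cohomology in degree j - 2.

    If every induced cycle of length > 3 has length >= p + 3, this cohomology
    vanishes in degree j - 2 >= 1 as soon as |W| < p + j, by induction on |W|:
    deleting a vertex v reduces degree l to degree l - 1 on the clique complex of
    the neighbourhood of v.  For l = 1 the remaining datum is a function constant on
    the edges of the neighbourhood of v; it has to be constant along every path of
    G[W] - v joining two neighbours of v, since a shortest path violating this would
    close up through v to an induced cycle.  Conversely, an induced cycle of length
    c > 3 has non-zero first cohomology, which sits in Tor_{c-3}(K, I) in degree c. *)

Require Import Defs.
From mathcomp Require Import all_boot all_order all_algebra.
From mathcomp Require Import mpoly.
From mathcomp Require Import boolp classical_sets constructive_ereal ring.
(* classical_sets shadows lemma names such as subset_trans; restore them. *)
From mathcomp Require Import fintype finset zify.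

Set Implicit Arguments.
Unset Strict Implicit.
Unset Printing Implicit Defensive.

Import Order.TTheory GRing.Theory Num.Theory.

Local Open Scope ring_scope.

(** * Signed cochains on the subsets of a finite set *)

Section Cochains.
Variables (K : fieldType) (T : finType).
Implicit Types (W F H : {set T}) (f g : {set T} -> K) (s : T -> {set T} -> K).

Definition coboundary s f F : K := \sum_(k in F) s k F * f (F :\ k).

(* The only properties of incidence signs that matter; they are inherited by    *)
(* F |-> s k (v |: F) (links) and shared by the Koszul signs read on complements. *)
Definition orientation W s : Prop :=
  (forall k F, F \subset W -> k \in F -> s k F * s k F = 1) /\
  (forall k l F, F \subset W -> k \in F -> l \in F -> k != l ->
     s k F * s l (F :\ k) = - (s l F * s k (F :\ l))).

Lemma orientation_sub W W' s :
  W' \subset W -> orientation W s -> orientation W' s.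
Proof.
move=> sub [s1 s2]; split=> [k F FW|k l F FW].
  exact: s1 (subset_trans FW sub).
exact: s2 (subset_trans FW sub).
Qed.

Lemma coboundaryB s f g F :
  coboundary s (fun H => f H - g H) F = coboundary s f F - coboundary s g F.
Proof.
by rewrite /coboundary -sumrB; apply: eq_bigr => k _; rewrite mulrBr.
Qed.

Lemma eq_coboundary s f g F :
  (forall k, k \in F -> f (F :\ k) = g (F :\ k)) ->
  coboundary s f F = coboundary s g F.
Proof. by move=> h; apply: eq_bigr => k /h ->. Qed.

Lemma coboundaryU1 s f v F : v \notin F ->
  coboundary s f (v |: F) =
  s v (v |: F) * f F + \sum_(k in F) s k (v |: F) * f (v |: (F :\ k)).
Proof.
move=> vF; rewrite /coboundary (bigD1 v) ?setU11 //= setU1K //; congr (_ + _).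
apply: eq_big => [k|k /andP[]]; rewrite !inE.
  by case: eqVneq => [->|]; rewrite ?(negbTE vF) ?andbT.
move=> kvF kv; congr (_ * f _); apply/setP => l; rewrite !inE.
by case: (eqVneq l v) => [->|]; rewrite ?andbF ?orbF // eq_sym kv.
Qed.

Lemma coboundary_coboundary W s f F : orientation W s -> F \subset W ->
  coboundary s (coboundary s f) F = 0.
Proof.
move=> [_ sN] FW; rewrite /coboundary.
pose t k l := s k F * s l (F :\ k) * f (F :\ k :\ l).
transitivity (\sum_(k in F) \sum_(l in F | l != k) t k l).
  apply: eq_bigr => k _; rewrite mulr_sumr; apply: eq_big => [l|l _].
    by rewrite !inE andbC.
  by rewrite mulrA.
(* [enum_rank] orders [T], so that the terms with [l] before [k] can be matched with those with [k]
   before [l]; matched terms cancel by [sN]. *)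
transitivity (\sum_(k in F) (\sum_(l in F | (enum_rank l < enum_rank k)%N) t k l +
                             \sum_(l in F | (enum_rank k < enum_rank l)%N) t k l)).
  apply: eq_bigr => k _.
  rewrite (bigID (fun l => (enum_rank l < enum_rank k)%N)) /=.
  congr (_ + _); apply: eq_bigl => l; case: (l \in F) => //=.
    by case: eqVneq => [->|]; rewrite ?ltnn.
  rewrite -leqNgt leq_eqVlt (inj_eq val_inj) (inj_eq enum_rank_inj) eq_sym.
  by case: eqVneq => [->|]; rewrite ?ltnn.
rewrite big_split /= [X in X + _](exchange_big_dep (mem F)) //=; last first.
  by move=> k l kF /andP[].
rewrite -big_split big1 // => k kF /=.
rewrite [X in X + _](eq_bigl (fun l => (l \in F) &&
  (enum_rank k < enum_rank l)%N)); last first.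
  by move=> l; rewrite kF.
rewrite -big_split big1 //= => l /andP[lF kl]; rewrite /t.
rewrite sN //; last by apply: contraTneq kl => ->; rewrite ltnn.
by rewrite mulNr setDDl setUC -setDDl addNr.
Qed.

(* The primitive is the contraction of f with the cone point v. *)
Lemma coboundary_cone W s f v F : orientation W s -> v \in W -> F \subset W ->
  (v \notin F -> coboundary s f (v |: F) = 0) ->
  coboundary s (fun H => if v \in H then 0 else s v (v |: H) * f (v |: H)) F
  = f F.
Proof.
move=> [s1 sN] vW FW; case: (boolP (v \in F)) => vF.
  move=> _; rewrite /coboundary (bigD1 v) //= !inE eqxx /= setD1K //.
  rewrite mulrA s1 // mul1r big1 ?addr0 // => k /andP[kF kv].
  by rewrite !inE vF eq_sym kv mulr0.
move=> /(_ isT); rewrite coboundaryU1 // => /eqP; rewrite addr_eq0 => /eqP e.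
have vFW : v |: F \subset W by rewrite subUset sub1set vW.
(* Inserting the square of [s v (v |: F)], which is 1, makes the cocycle relation [e] applicable. *)
rewrite -[RHS]mul1r -(s1 v (v |: F)) ?setU11 // -mulrA e mulrN mulr_sumr.
rewrite -sumrN; apply: eq_bigr => k kF; rewrite !inE (negbTE vF) andbF.
have kv : k != v by apply: contraNneq vF => <-.
have ek : v |: (F :\ k) = (v |: F) :\ k.
  apply/setP => l; rewrite !inE.
  by case: (eqVneq l v) => [->|]; rewrite ?andbF ?orbF // eq_sym kv.
have := sN k v _ vFW; rewrite setU1K // -ek !inE eqxx kF orbT => /(_ isT isT kv) h.
have s1k : s k F * s k F = 1 by apply: s1.
have s1v : s v (v |: F) * s v (v |: F) = 1 by apply: s1; rewrite ?setU11.
have s1kv : s k (v |: F) * s k (v |: F) = 1.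
  by apply: s1; rewrite // !inE kF orbT.
transitivity ((s k F * s v (v |: F)) * s v (v |: F) *
  s v (v |: (F :\ k)) * f (v |: (F :\ k))).
  by rewrite -[s k F * _ * _]mulrA s1v mulr1 mulrA.
have -> : s k F * s v (v |: F) = - (s k (v |: F) * s v (v |: (F :\ k))).
  by rewrite h opprK mulrC.
have s1v' : s v (v |: (F :\ k)) * s v (v |: (F :\ k)) = 1.
  by apply: s1; rewrite ?setU11 // ek (subset_trans (subsetDl _ _)).
transitivity (- (s k (v |: F) * s v (v |: F) *
  (s v (v |: (F :\ k)) * s v (v |: (F :\ k))) * f (v |: (F :\ k)))); first by ring.
by rewrite s1v'; ring.
Qed.

End Cochains.

(** * Cliques, and induced cycles obtained from shortest paths *)

Section Graphs.
Variables (T : finType) (e : rel T).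
Hypotheses (e_sym : ssrbool.symmetric e) (e_irr : irreflexive e).

Definition clique (F : {set T}) : bool :=
  [forall x in F, forall y in F, (x != y) ==> e x y].

Lemma cliqueP (F : {set T}) : reflect {in F &, forall x y, x != y -> e x y} (clique F).
Proof.
apply: (iffP forall_inP) => [h x y xF yF|h x xF].
  by have /forall_inP/(_ y yF)/implyP := h x xF.
by apply/forall_inP => y yF; apply/implyP; apply: h.
Qed.

Lemma clique_sub (F G : {set T}) : F \subset G -> clique G -> clique F.
Proof.
by move=> /subsetP FG /cliqueP h; apply/cliqueP => x y /FG xG /FG yG; apply: h.
Qed.

Lemma cliqueU1 v (F : {set T}) : {in F, forall u, e v u} -> clique (v |: F) = clique F.
Proof.
move=> vF; apply/idP/idP; first exact/clique_sub/subsetUr.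
move=> /cliqueP h; apply/cliqueP => x y; rewrite !inE.
move=> /predU1P[->|xF] /predU1P[->|yF]; rewrite ?eqxx //.
- by move=> _; apply: vF.
- by move=> _; rewrite e_sym; apply: vF.
- exact: h.
Qed.

Lemma next_cons_nth (v : T) s i : uniq (v :: s) -> (i < size s)%N ->
  next (v :: s) (nth v s i) = nth v s i.+1.
Proof.
move=> us lt; rewrite next_nth; have -> : nth v s i = nth v (v :: s) i.+1 by [].
by rewrite mem_nth // index_uniq.
Qed.

Lemma induced_cycle_cons (v x0 : T) s : uniq (v :: s) -> (1 < size s)%N ->
  (forall i, (i < size s)%N ->
     e v (nth x0 s i) = (i == 0%N) || (i.+1 == size s)) ->
  (forall i j, (i < j < size s)%N -> e (nth x0 s i) (nth x0 s j) = (j == i.+1)) ->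
  induced_cycle e [set x in v :: s].
Proof.
move=> us s1 ev es; exists (v :: s); split => //; first by move=> x; rewrite inE.
have us' : uniq s by have /andP[] := us.
have vs : v \notin s by have /andP[] := us.
(* With default value [v], [nth v s i.+1] is the successor also at the last index, where the cycle
   returns to [v]. *)
have ev' i : (i < size s)%N ->
    e v (nth v s i) = (i == 0%N) || (i.+1 == size s).
  by move=> lt; rewrite -ev // (set_nth_default x0).
have es' i j : (i < j < size s)%N -> e (nth v s i) (nth v s j) = (j == i.+1).
  move=> /andP[ij jlt]; rewrite -es ?ij // (set_nth_default x0) ?(ltn_trans ij) //.
  by rewrite (set_nth_default x0 v jlt).
have nextv : next (v :: s) v = nth v s 0.
  by rewrite next_nth inE eqxx /= eqxx.
have nth_v i : (i < size s)%N -> (v == nth v s i) = false.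
  by move=> lt; apply: contraNF vs => /eqP ->; rewrite mem_nth.
have nthSv i : (i < size s)%N -> (v == nth v s i.+1) = (i.+1 == size s).
  rewrite leq_eqVlt => /predU1P[->|lt]; first by rewrite nth_default // !eqxx.
  by rewrite nth_v // ltn_eqF.
have half i : (i < size s)%N -> e v (nth v s i) =
    (nth v s i == next (v :: s) v) || (v == next (v :: s) (nth v s i)).
  move=> lt; rewrite ev' // nextv next_cons_nth // nthSv // nth_uniq //.
  exact: leq_trans s1.
have nthS i j : (i < size s)%N -> (j < size s)%N ->
    (nth v s j == nth v s i.+1) = (j == i.+1).
  move=> il jl; have := il; rewrite leq_eqVlt => /predU1P[e1|lt].
    by rewrite [nth v s i.+1]nth_default ?e1 // eq_sym nth_v // ltn_eqF.
  by rewrite nth_uniq.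
move=> a b; rewrite !inE.
move=> /predU1P[->|/(nthP v)[i il <-]] /predU1P[->|/(nthP v)[j jl <-]].
- by rewrite e_irr nextv orbb nth_v // ltnW.
- exact: half.
- by rewrite e_sym half // orbC.
rewrite !next_cons_nth // !nthS //.
case: (ltngtP i j) => [lt|lt|->].
- by rewrite es' ?lt // (_ : (i == j.+1) = false) ?orbF //; lia.
- by rewrite e_sym es' ?lt // (_ : (j == i.+1) = false) //; lia.
- by rewrite e_irr ltn_eqF.
Qed.

(* A path between two neighbours of v that is shortest among those along which *)
(* h changes is induced and avoids other neighbours of v; closed up through v, *)
(* it is an induced cycle.                                                     *)
Lemma eq_on_neighbour_path (R : Type) (h : T -> R) (W : {set T}) v u p :
  (forall C, induced_cycle e C -> C \subset W -> (#|C| <= 3)%N) ->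
  {in W &, forall x y, e v x -> e v y -> e x y -> h x = h y} ->
  v \in W -> u \in W -> e v u -> e v (last u p) ->
  path [rel x y | [&& e x y, y \in W & y != v]] u p ->
  h u = h (last u p).
Proof.
move=> noC hloc vW; have [k] := ubnP (size p).
elim: k u p => // k IH u p; rewrite ltnS => pk uW vu vl pp.
set r := [rel x y | _] in pp IH.
pose s := u :: p.
have nthE i : (i <= size p)%N -> nth u s i = last u (take i p).
  case: i => [|i] ip; first by rewrite take0.
  by rewrite (last_nth u) size_takel //= nth_take.
have lastE i : (i <= size p)%N -> last (nth u s i) (drop i p) = last u p.
  by move=> ip; rewrite nthE // -last_cat cat_take_drop.
have pathE i : (i <= size p)%N -> path r u (take i p) && path r (nth u s i) (drop i p).
  by move=> ip; rewrite nthE // -cat_path cat_take_drop.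
have pathS i : (i < size p)%N -> r (nth u s i) (nth u s i.+1).
  by move=> ip; move/pathP: pp => /(_ u i ip).
have sW i : (i <= size p)%N -> (nth u s i \in W) && (nth u s i != v).
  case: i => [_|i ip]; first by rewrite uW /=; apply: contraTneq vu => ->; rewrite e_irr.
  by have /and3P[_ -> ->] := pathS i ip.
(* Splicing in a shortcut [q] from the [i]-th vertex to the end gives a shorter path, to which
   induction applies. *)
have short i q : (i <= size p)%N -> path r (nth u s i) q ->
    last (nth u s i) q = last u p -> (i + size q < size p)%N -> h u = h (last u p).
  move=> ip pq lq sq; have := IH u (take i p ++ q).
  rewrite last_cat -nthE // lq => ->//.
    by rewrite size_cat size_takel // (leq_trans sq).
  by rewrite cat_path -nthE // pq; have /andP[-> _] := pathE i ip.
(* An interior neighbour of [v] cuts the path into two shorter ones between neighbours of [v]. *)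
have [[j]|inner] := pselect (exists j, [&& 0 < j, j < size p & e v (nth u s j)])%N.
  move=> /and3P[j0 jp vj]; have jp' := ltnW jp.
  have /andP[p1 p2] := pathE j jp'.
  have /andP[jW _] := sW j jp'.
  transitivity (h (nth u s j)).
    rewrite nthE //; apply: IH => //; rewrite -?nthE //.
    by rewrite size_takel // (leq_trans jp).
  rewrite -(lastE j) //; apply: IH => //; last by rewrite lastE.
  by rewrite size_drop (leq_trans _ pk) // ltn_subrL j0 (leq_trans _ jp).
(* A repeated vertex or a chord provides a shortcut. *)
have [[i [j]]|chordless] := pselect (exists i j,
    [&& i < j, j <= size p & (nth u s i == nth u s j) ||
                             (i.+1 < j) && e (nth u s i) (nth u s j)])%N.
  move=> /and3P[ij jp /orP[/eqP E|/andP[ij2 E]]].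
    have ip : (i <= size p)%N := leq_trans (ltnW ij) jp.
    apply: (short i (drop j p)); rewrite // ?E ?lastE //.
      by have /andP[] := pathE j jp.
    by rewrite size_drop; lia.
  have ip : (i <= size p)%N := leq_trans (ltnW ij) jp.
  apply: (short i (nth u s j :: drop j p)); rewrite //= ?lastE //.
    by rewrite E; have /andP[-> ->] := sW j jp; have /andP[] := pathE j jp.
  by rewrite size_drop; lia.
have uniq_s : uniq s.
  apply/(uniqP u) => i j; rewrite !inE /= !ltnS => ip jp E.
  case: (ltngtP i j) => // lt; case: chordless; [exists i, j|exists j, i].
    by rewrite lt jp E eqxx.
  by rewrite lt ip E eqxx.
have [p1|p1] := leqP (size p) 1.
  case: (p) p1 pp vl => [|y [|//]] //= _ /andP[/and3P[uy yW _] _] vy.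
  exact: hloc.
(* The path now has at least three vertices; closed up through [v] it has at least four, against
   [noC]. *)
have cyc : induced_cycle e [set x in v :: s].
  apply: (@induced_cycle_cons v u); rewrite ?ltnS ?(ltnW p1) //.
  - rewrite cons_uniq uniq_s andbT; apply/negP => /(nthP u)[i].
    by rewrite /= ltnS => /sW/andP[_] /[swap] -> /eqP.
  - move=> i; rewrite /= ltnS eqSS => ip.
    case: (posnP i) => [->|i0] //=; have [E|ne] := eqVneq i (size p).
      by rewrite nthE // E take_size vl.
    apply/negP => vi; apply: inner; exists i.
    by rewrite i0 vi ltn_neqAle ne ip.
  - move=> i j /andP[ij]; rewrite /= ltnS => jp.
    have [->|ne] := eqVneq j i.+1.
      by have /and3P[] := pathS i (leq_trans ij jp).
    apply/negP => E; apply: chordless; exists i, j.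
    by rewrite ij jp E orbC ltn_neqAle eq_sym ne ij.
have := noC _ cyc; suff -> : #|[set x in v :: s]| = (size p).+2.
  move=> h3; have /h3 : [set x in v :: s] \subset W.
    apply/fintype.subsetP => x; rewrite in_set in_cons => /predU1P[->//|].
    by move=> /(nthP u)[i]; rewrite /= ltnS => /sW/andP[iW _] <-.
  by rewrite !ltnS leqNgt p1.
rewrite cardsE; apply/eqP; rewrite -[_.+2]/(size (v :: s)).
apply/eqP; apply/card_uniqP; rewrite cons_uniq uniq_s andbT.
apply/negP => /(nthP u)[i].
by rewrite /= ltnS => /sW/andP[_] /[swap] -> /eqP.
Qed.

End Graphs.

(** * Vanishing of the cohomology of clique complexes *)

Section CliqueCohomology.
Variables (K : fieldType) (T : finType) (e : rel T).
Hypotheses (e_sym : ssrbool.symmetric e) (e_irr : irreflexive e).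
Implicit Types (W F H : {set T}) (f g : {set T} -> K) (s : T -> {set T} -> K).

Lemma card1_setD1 F k l : #|F| = 2 -> k \in F -> l \in F -> k != l ->
  F :\ k = [set l].
Proof.
move=> F2 kF lF kl; apply/esym/eqP; rewrite eqEcard sub1set !inE lF eq_sym kl /=.
by rewrite cards1; move: F2; rewrite (cardsD1 k) kF add1n => -[->].
Qed.

Lemma coboundary_pair s f F k l : #|F| = 2 -> k \in F -> l \in F -> k != l ->
  coboundary s f F = s k F * f [set l] + s l F * f [set k].
Proof.
move=> F2 kF lF kl; rewrite /coboundary (bigD1 k) //= (bigD1 l) /=; last first.
  by rewrite lF eq_sym.
rewrite (card1_setD1 F2 kF lF kl) (card1_setD1 F2 lF kF) 1?eq_sym //.
rewrite big1 ?addr0 // => x /andP[/andP[xF xk] xl].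
have : (2 < #|F|)%N; last by rewrite F2.
rewrite (cardsD1 k) kF (cardsD1 l) !inE lF eq_sym kl (cardsD1 x).
by rewrite !inE xF xk xl.
Qed.

(* Rescaling by the orientation of singletons turns the signs of a 1-coboundary *)
(* into those of a difference.                                                 *)
Lemma coboundary_pair_scaled W s f F k l : orientation W s -> F \subset W ->
  #|F| = 2 -> k \in F -> l \in F -> k != l ->
  coboundary s f F = s k F * s l [set l] *
    (s l [set l] * f [set l] - s k [set k] * f [set k]).
Proof.
move=> [s1 sN] FW F2 kF lF kl; rewrite (coboundary_pair s f F2 kF lF kl).
have := sN k l F FW kF lF kl.
rewrite (card1_setD1 F2 kF lF kl) (card1_setD1 F2 lF kF) 1?eq_sym // => h.
have sl : s l [set l] * s l [set l] = 1.
  by apply: s1; rewrite ?set11 // sub1set (subsetP FW).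
have sk : s k [set k] * s k [set k] = 1.
  by apply: s1; rewrite ?set11 // sub1set (subsetP FW).
rewrite mulrBr; congr (_ + _).
  by rewrite mulrA -[_ * s l _ * s l _]mulrA sl mulr1.
by rewrite h mulNr opprK mulrA -[_ * s k _ * s k _]mulrA sk mulr1.
Qed.

Lemma coboundary_link W s v : v \in W -> orientation W s ->
  orientation (W :\ v) (fun k F => s k (v |: F)).
Proof.
move=> vW [s1 sN].
have sub F : F \subset W :\ v -> v |: F \subset W.
  by move=> /subsetD1P[FW _]; rewrite subUset sub1set vW.
have D1 k F : F \subset W :\ v -> k \in F -> v |: (F :\ k) = (v |: F) :\ k.
  move=> /subsetD1P[_ vF] kF; apply/setP => l; rewrite !inE.
  case: (eqVneq l v) => [->|]; rewrite ?andbF ?orbF //= andbT.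
  by apply/esym; apply: contraNneq vF => ->.
split=> [k F /sub FW kF|k l F FW kF lF kl]; first by apply: s1; rewrite // !inE kF orbT.
by rewrite !D1 //; apply: sN; rewrite ?sub // !inE ?kF ?lF orbT.
Qed.

(** A primitive on the link of [v] is moved to the sets containing [v] and extended by 0. On a face
    through [v] the term deleting [v] then vanishes and the link equation remains; on other faces
    both sides are 0. *)
Lemma clique_cohomology_link W s d f v :
  orientation W s -> v \in W ->
  (forall F, F \subset W :\ v -> clique e F -> #|F| = d.+1 -> f F = 0) ->
  (exists g, forall F, F \subset W :\ v -> {in F, forall u, e v u} ->
     clique e F -> #|F| = d -> \sum_(k in F) s k (v |: F) * g (F :\ k) = f (v |: F)) ->
  exists g, forall F, F \subset W -> clique e F -> #|F| = d.+1 ->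
    coboundary s g F = f F.
Proof.
move=> sW vW f0 [g1 hg1].
exists (fun H => if v \in H then g1 (H :\ v) else 0) => F FW cF Fd.
have [vF|vF] := boolP (v \in F); last first.
  rewrite f0 // ?subsetD1 ?FW // /coboundary big1 // => k kF.
  by rewrite !inE (negbTE vF) andbF mulr0.
have FvW : F :\ v \subset W :\ v by apply: setSD.
rewrite -{1}(setD1K vF) coboundaryU1 ?inE ?eqxx //= mulr0 add0r.
rewrite -[in RHS](setD1K vF) -hg1 //.
- apply: eq_bigr => k; rewrite !inE => /andP[kv kF]; rewrite eqxx /=.
  by rewrite setU1K // !inE eqxx andbF.
- by move=> u; rewrite !inE => /andP[uv uF]; apply: (cliqueP _ _ cF); rewrite // eq_sym.
- exact: clique_sub (subsetDl _ _) cF.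
- by move: Fd; rewrite (cardsD1 v) vF add1n => -[].
Qed.

(** The coboundary of [f] at [v |: F] is the link coboundary at [F] plus the term deleting [v], a
    multiple of [f F], hence 0. *)
Lemma link_cocycle W s d f v :
  orientation W s -> v \in W ->
  (forall F, F \subset W :\ v -> clique e F -> #|F| = d.+1 -> f F = 0) ->
  (forall F, F \subset W -> clique e F -> #|F| = d.+2 -> coboundary s f F = 0) ->
  forall F, F \subset W :\ v -> {in F, forall u, e v u} -> clique e F ->
    #|F| = d.+1 -> coboundary (fun k F => s k (v |: F)) (fun H => f (v |: H)) F = 0.
Proof.
move=> sW vW f0 fc F FW vF cF Fd; have /subsetD1P[FW' v_F] := FW.
have := fc (v |: F); rewrite subUset sub1set vW FW' cliqueU1 // cardsU1 v_F Fd.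
by move=> /(_ isT cF erefl); rewrite coboundaryU1 // f0 // mulr0 add0r.
Qed.

Lemma clique_cohomology1 W s f v : orientation W s -> v \in W ->
  (forall C, induced_cycle e C -> C \subset W -> (#|C| <= 3)%N) ->
  (forall F, F \subset W :\ v -> clique e F -> #|F| = 2 -> f F = 0) ->
  (forall F, F \subset W -> clique e F -> #|F| = 3 -> coboundary s f F = 0) ->
  exists g, forall F, F \subset W -> clique e F -> #|F| = 2 ->
    coboundary s g F = f F.
Proof.
move=> sW vW noC f0 fc.
have sv := coboundary_link vW sW.
pose h u := s u (v |: [set u]) * f (v |: [set u]).
have hloc : {in W &, forall x y, e v x -> e v y -> e x y -> h x = h y}.
  move=> x y xW yW vx vy xy.
  have xy' : x != y by apply: contraTneq xy => ->; rewrite e_irr.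
  have xv : x != v by apply: contraTneq vx => ->; rewrite e_irr.
  have yv : y != v by apply: contraTneq vy => ->; rewrite e_irr.
  have FW : [set x; y] \subset W :\ v by rewrite subUset !sub1set !inE xv xW yv.
  have F2 : #|[set x; y]| = 2 by rewrite cards2 xy'.
  have := link_cocycle sW vW f0 fc FW.
  rewrite (coboundary_pair_scaled _ sv FW F2 (set21 _ _) (set22 _ _) xy') F2.
  have vF : {in [set x; y], forall u, e v u} by move=> u /set2P[] ->.
  have cF : clique e [set x; y].
    by apply/cliqueP => a b /set2P[->|->] /set2P[->|->]; rewrite ?eqxx // e_sym.
  move=> /(_ vF cF erefl) /eqP; rewrite mulf_eq0 mulf_eq0 -/(h x) -/(h y).
  have nz a (G : {set T}) : G \subset W :\ v -> a \in G -> (s a (v |: G) == 0) = false.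
    move=> GW aG; have := sv.1 a G GW aG; case: eqP => // ->.
    by rewrite mul0r => /esym/eqP; rewrite oner_eq0.
  rewrite !nz ?set21 ?set11 ?sub1set ?inE ?yv ?yW //= subr_eq0.
  by move=> /eqP.
pose r := [rel x y | [&& e x y, y \in W & y != v]].
pose near x u := [&& u \in W, e v u & connect r u x].
(* [gam] spreads [h] over the connected components of the graph on [W :\ v], with value 0 on
   components without neighbours of [v]. That the picked neighbour does not matter is
   [eq_on_neighbour_path]. *)
pose gam x := if [pick u | near x u] is Some u then h u else 0.
have gam_conn x y : x \in W -> x != v -> y \in W -> y != v -> e x y -> gam x = gam y.
  move=> xW xv yW yv xy; have E u : near x u = near y u.
    rewrite /near; case: (u \in W) => //=; case: (e v u) => //=.
    by apply/idP/idP => /connect_trans; apply; apply: connect1;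
      rewrite /= ?xy ?yW ?yv // e_sym xy xW xv.
  by rewrite /gam; congr (if _ is Some u then h u else 0); apply: eq_pick.
have gam_h x : x \in W -> e v x -> gam x = h x.
  move=> xW vx; rewrite /gam; case: pickP => [u|/(_ x)]; last first.
    by rewrite /near xW vx connect0.
  move=> /and3P[uW vu /connectP[p pp E]]; rewrite E.
  by apply: (eq_on_neighbour_path e_sym e_irr noC hloc vW uW vu) pp; rewrite -E.
have nz a (F : {set T}) : F \subset W -> a \in F -> s a F * s a F = 1 by exact: sW.1.
(* The sum merely reads off the element of a singleton. The two signs undo the rescaling of
   [coboundary_pair_scaled], and the minus sign makes up for the value 0 at [v] being the
   minuend. *)
exists (fun H => if H == [set v] then 0 else
   \sum_(x in H) - (s v [set v] * s x H * gam x)).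
have gE x : x != v -> (if [set x] == [set v] then 0 else
    \sum_(x0 in [set x]) - (s v [set v] * s x0 [set x] * gam x0)) =
    - (s v [set v] * s x [set x] * gam x).
  move=> xv; rewrite big_set1 ifF //; apply: contra_neqF xv => /eqP E.
  by apply/set1P; rewrite -E set11.
move=> F FW cF F2.
have [vF|vF] := boolP (v \in F); last first.
  rewrite f0 ?subsetD1 ?FW //; have [x xF] : exists x, x \in F.
    by apply/card_gt0P; rewrite F2.
  have [y] : exists y, y \in F :\ x.
    by apply/card_gt0P; move: F2; rewrite (cardsD1 x) xF add1n => -[->].
  rewrite !inE => /andP[yx yF]; have xy : x != y by rewrite eq_sym.
  rewrite (coboundary_pair_scaled _ sW FW F2 xF yF xy).
  have xv : x != v by apply: contraNneq vF => <-.
  have yv : y != v by apply: contraNneq vF => <-.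
  have xW := subsetP FW _ xF; have yW := subsetP FW _ yF.
  rewrite !gE // !mulrN ![s v _ * _]mulrC !mulrA !nz ?set11 ?sub1set // !mul1r.
  by rewrite (gam_conn x y) ?subrr ?mulr0 //; apply: (cliqueP _ _ cF).
have [y] : exists y, y \in F :\ v.
  by apply/card_gt0P; move: F2; rewrite (cardsD1 v) vF add1n => -[->].
rewrite !inE => /andP[yv yF]; have vy : v != y by rewrite eq_sym.
have yW := subsetP FW _ yF.
have vy_e : e v y by apply: (cliqueP _ _ cF).
rewrite (coboundary_pair_scaled _ sW FW F2 yF vF yv) eqxx gE // mulr0 sub0r.
have -> : gam y = s y F * f F.
  rewrite gam_h // /h; have -> // : v |: [set y] = F.
  by rewrite -(card1_setD1 F2 vF yF vy) setD1K.
have h1 := nz y [set y] _ _; have h2 := nz v [set v] _ _; have h3 := nz y F FW yF.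
transitivity ((s y F * s y F) * (s v [set v] * s v [set v]) *
  (s y [set y] * s y [set y]) * f F); first by ring.
by rewrite h3 h2 ?h1 ?set11 ?sub1set // !mul1r.
Qed.

(** Sets of [d.+2] vertices are faces of dimension at least 1. Passing to the neighbourhood of [v]
    loses at least one vertex and exactly one degree, which preserves the bound on [W]. *)
Lemma clique_cohomology p W s d f : orientation W s ->
  (#|W| <= p + d.+2)%N ->
  (forall C, induced_cycle e C -> C \subset W -> (3 < #|C|)%N -> (p + 3 <= #|C|)%N) ->
  (forall F, F \subset W -> clique e F -> #|F| = d.+3 -> coboundary s f F = 0) ->
  exists g, forall F, F \subset W -> clique e F -> #|F| = d.+2 ->
    coboundary s g F = f F.
Proof.
have [m] := ubnP #|W|; elim: m W s d f => // m IH W s d f; rewrite ltnS.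
move=> Wm sW Wp noC fc; have [W0|[v vW]] := set_0Vmem W.
  exists (fun=> 0) => F; rewrite W0 subset0 => /eqP ->.
  by rewrite cards0.
have cWv : (#|W :\ v| < #|W|)%N by rewrite (cardsD1 v W) vW.
have sWv : W :\ v \subset W by apply: subsetDl.
have [||||g0 hg0] := IH (W :\ v) s d f (leq_trans cWv Wm).
- exact: orientation_sub sWv sW.
- exact: leq_trans (ltnW cWv) Wp.
- by move=> C iC CW; apply: noC => //; apply: subset_trans CW sWv.
- by move=> F FW; apply: fc; apply: subset_trans FW sWv.
(* Subtracting the coboundary of a primitive over [W :\ v] leaves a cocycle that vanishes on the
   cliques avoiding [v]. *)
pose f1 H := f H - coboundary s g0 H.
have f10 F : F \subset W :\ v -> clique e F -> #|F| = d.+2 -> f1 F = 0.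
  by move=> FW cF Fd; rewrite /f1 hg0 // subrr.
have f1c F : F \subset W -> clique e F -> #|F| = d.+3 -> coboundary s f1 F = 0.
  move=> FW cF Fd; rewrite coboundaryB (coboundary_coboundary _ sW FW) subr0.
  exact: fc.
suff [g hg] : exists g, forall F, F \subset W -> clique e F -> #|F| = d.+2 ->
    coboundary s g F = f1 F.
  exists (fun H => g H - (- g0 H)) => F FW cF Fd; rewrite coboundaryB hg //.
  have -> : coboundary s (fun H => - g0 H) F = - coboundary s g0 F.
    by rewrite /coboundary -sumrN; apply: eq_bigr => k _; rewrite mulrN.
  by rewrite opprK subrK.
case: d => [|d] in Wp fc g0 hg0 f1 f10 f1c *.
  (* In the lowest degree [W] has at most [p + 2] vertices, too few for an induced cycle of length
     above 3. *)
  apply: (clique_cohomology1 sW vW _ f10 f1c) => C iC CW.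
  rewrite leqNgt; apply/negP => C3; have := noC C iC CW C3.
  by have := subset_leq_card CW; lia.
apply: (clique_cohomology_link sW vW f10).
pose N := [set u in W | e v u].
have NWv : N \subset W :\ v.
  apply/fintype.subsetP => u; rewrite !inE => /andP[-> vu]; rewrite andbT.
  by apply: contraTneq vu => ->; rewrite e_irr.
have NP F : F \subset W :\ v -> {in F, forall u, e v u} -> F \subset N.
  move=> /subsetD1P[FW _] vF; apply/fintype.subsetP => u uF.
  by rewrite inE (subsetP FW) // vF.
have PN F : F \subset N -> {in F, forall u, e v u}.
  by move=> FN u /(subsetP FN); rewrite inE => /andP[].
have cN := leq_ltn_trans (subset_leq_card NWv) cWv.
have sN := orientation_sub NWv (coboundary_link vW sW).
have [|||g hg] := IH N _ d (fun H => f1 (v |: H)) (leq_trans cN Wm) sN.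
- by rewrite -ltnS (leq_trans cN) // (leq_trans Wp) // !addnS.
- move=> C iC CN; apply: noC => //.
  exact: subset_trans CN (subset_trans NWv sWv).
- move=> F FN cF Fd; apply: (link_cocycle sW vW f10 f1c) => //.
    exact: subset_trans FN NWv.
  exact: PN.
by exists g => F FW vF cF Fd; apply: hg => //; apply: NP.
Qed.

End CliqueCohomology.

(** If [W2] has a point, coning from it respects the subcomplex of faces [F] with [F :|: W2] a
    clique. If [W2] is empty, this is the connecting map of the pair: a primitive [u] of [f] on the
    full simplex restricts to a cocycle of the clique complex one degree lower, and a primitive of
    that restriction corrects [u] so that it vanishes on cliques. *)
Lemma relative_clique_cohomology (K : fieldType) (T : finType) (e : rel T)
    (e_sym : ssrbool.symmetric e) (e_irr : irreflexive e) (p j : nat)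
    (W W2 : {set T}) (s : T -> {set T} -> K) (f : {set T} -> K) :
  orientation W s -> W2 \subset W ->
  (forall C, induced_cycle e C -> (3 < #|C|)%N -> (p + 3 <= #|C|)%N) ->
  (W2 = finset.set0 -> (2 < j)%N /\ (#|W| < p + j)%N) ->
  (forall F : {set T}, F \subset W -> clique e (F :|: W2) -> #|F| = j -> f F = 0) ->
  (forall F : {set T}, F \subset W -> #|F| = j.+1 -> coboundary s f F = 0) ->
  exists g : {set T} -> K,
    (forall H : {set T}, H \subset W -> clique e (H :|: W2) -> #|H|.+1 = j -> g H = 0) /\
    (forall F : {set T}, F \subset W -> #|F| = j -> coboundary s g F = f F).
Proof.
move=> sW W2W noC hW f0 fc.
have cone v : v \in W -> exists2 g : {set T} -> K,
    (forall F : {set T}, F \subset W -> #|F| = j -> coboundary s g F = f F) &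
    (forall H : {set T}, v \notin H -> f (v |: H) = 0 -> g H = 0) /\
    (forall H : {set T}, v \in H -> g H = 0).
  move=> vW; exists (fun H : {set T} => if v \in H then 0 else s v (v |: H) * f (v |: H)).
    move=> F FW Fj; apply: (coboundary_cone sW vW FW) => vF.
    by apply: fc; rewrite ?subUset ?sub1set ?vW // cardsU1 vF Fj.
  by split=> H vH; [rewrite (negbTE vH) => ->; rewrite mulr0|rewrite vH].
have [W20|[v vW2]] := set_0Vmem W2; last first.
  (* Adjoining [v] to [H] does not change [H :|: W2]. *)
  have [g gf [g0 g0']] := cone v (subsetP W2W _ vW2); exists g; split=> // H HW cH Hj.
  have [/g0' //|vH] := boolP (v \in H); apply: g0 => //; apply: f0.
  - by rewrite subUset sub1set (subsetP W2W).
  - by rewrite setUAC [[set v] :|: W2](setUidPr _) ?sub1set // finset.setUC.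
  - by rewrite cardsU1 vH.
have [j2 Wj] := hW W20; rewrite W20 in f0 *.
have [d Ed] : exists d, j = d.+3 by case: (j) j2 => [|[|[|d]]] // _; exists d.
subst j; have f0' (F : {set T}) : F \subset W -> clique e F -> #|F| = d.+3 -> f F = 0.
  by move=> FW cF; apply: f0; rewrite // setU0.
have [E|[v vW]] := set_0Vmem W.
  exists (fun=> 0); split=> // F; rewrite E subset0 => /eqP ->.
  by rewrite cards0.
have [u uf _] := cone v vW.
have [|||g gu] := @clique_cohomology _ _ e e_sym e_irr p W s d u sW.
- by rewrite -ltnS -addnS.
- by move=> C iC _; apply: noC.
- by move=> F FW cF Fd; rewrite uf // f0'.
exists (fun H => u H - coboundary s g H); split=> [H HW|F FW Fd].
  by rewrite setU0 => cH [Hd]; rewrite gu // subrr.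
by rewrite coboundaryB (coboundary_coboundary _ sW FW) subr0 uf.
Qed.

(** * Multigraded pieces of the Koszul complex *)

Section Koszul.
Variables (K : fieldType) (n : nat) (e : rel 'I_n).
Local Notation S := {mpoly K[n]}.
Implicit Types (A B F W : {set 'I_n}) (M m : 'X_{1..n}).

(** Used for [r = 0], the support, and [r = 1], the variables of exponent at least 2. *)
Definition mnm_supp r M : {set 'I_n} := [set k | (r < M k)%N].

(** The Koszul sign for removing [k] from [A], where [A] is the complement of [F :\ k] in [W]. *)
Definition koszul_orientation W (k : 'I_n) F : K :=
  (-1) ^+ #|[set l in k |: (W :\: F) | (l < k)%N]|.

Lemma orientation_koszul W : orientation W (koszul_orientation W).
Proof.
split=> [k F _ _|]; first by rewrite /koszul_orientation -expr2 sqrr_sign.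
suff wlog_lt (k l : 'I_n) F : F \subset W -> k \in F -> l \in F -> (k < l)%N ->
    koszul_orientation W k F * koszul_orientation W l (F :\ k) =
    - (koszul_orientation W l F * koszul_orientation W k (F :\ l)).
  move=> k l F FW kF lF; rewrite neq_ltn => /orP[lt|lt]; first exact: wlog_lt.
  by rewrite (wlog_lt l k) ?opprK.
move=> FW kF lF kl; rewrite /koszul_orientation -!exprD.
have kW := subsetP FW _ kF.
set a := #|_|; set b := #|_|; set c := #|_|; set d := #|_|.
(* As [k < l], taking [l] out of [F] does not affect the count below [k], while taking [k] out
   raises the count below [l] by one. *)
have -> : a = d.
  apply: eq_card => j; rewrite !inE; case: (eqVneq j l) => [->|] //=.
  by rewrite ltnNge (ltnW kl) !andbF.
have -> : b = c.+1.
  rewrite /b (cardsD1 k) !inE eqxx kW kl orbT add1n; congr _.+1.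
  apply: eq_card => j; rewrite !inE; case: (eqVneq j k) => [->|] //=.
  by rewrite kF /= orbF; case: eqVneq kl => // ->; rewrite ltnn.
by rewrite addnS addnC exprS mulN1r.
Qed.

Definition koszul_ext i (v : {ffun koszul_basis n i -> S}) A : S :=
  oapp v 0 (insub A).

Lemma koszul_extE i (v : {ffun koszul_basis n i -> S}) (a : koszul_basis n i) :
  koszul_ext v (val a) = v a.
Proof. by rewrite /koszul_ext valK. Qed.

Lemma koszul_ext0 i (v : {ffun koszul_basis n i -> S}) A :
  #|A| != i -> koszul_ext v A = 0.
Proof. by move=> h; rewrite /koszul_ext insubN. Qed.

Definition koszul_elt i A (h : #|A| == i) : koszul_basis n i :=
  exist (fun B : {set 'I_n} => #|B| == i) A h.

Lemma koszul_ext_elt i (v : {ffun koszul_basis n i -> S}) A (h : #|A| == i) :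
  koszul_ext v A = v (koszul_elt h).
Proof. by rewrite -koszul_extE. Qed.

(* The coefficients in multidegree M, the basis vector e_A being indexed by the *)
(* complement of A in the support of M.                                        *)
Definition koszul_part i (v : {ffun koszul_basis n i -> S}) M F : K :=
  (koszul_ext v (mnm_supp 0 M :\: F))@_(M - mesym1 (mnm_supp 0 M :\: F))%MM.

Lemma mcoeff_mulX (p : S) (k : 'I_n) m :
  (p * 'X_k)@_m = if (0 < m k)%N then p@_(m - U_(k))%MM else 0.
Proof.
case: ifP => h; last first.
  apply/memN_msupp_eq0/negP => /msuppM_le/allpairsP[[m1 m2] /= [_]].
  rewrite msuppX inE => /eqP -> em; move: h; rewrite em mnmDE mnm1E eqxx.
  by rewrite addn1.
rewrite -[in LHS](@submK _ U_(k) m) 1?addmC ?mcoeffMX //.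
by rewrite lep1mP -lt0n.
Qed.

Lemma koszul_signE k A : koszul_sign K k A = ((-1) ^+ #|[set l in A | (l < k)%N]|)%:MP.
Proof. by rewrite /koszul_sign rmorphXn rmorphN1. Qed.

Lemma free_map_koszul i (v : {ffun koszul_basis n i.+1 -> S}) (b : koszul_basis n i) :
  free_map (@koszul_diff K n i) v b = \sum_(k | k \notin val b)
    koszul_ext v (k |: val b) * koszul_sign K k (k |: val b) * 'X_k.
Proof.
rewrite ffunE.
transitivity (\sum_(A : {set 'I_n}) koszul_ext v A * koszul_coef K A (val b)).
  rewrite [RHS](bigID (fun A : {set 'I_n} => #|A| == i.+1)) /=.
  rewrite [X in _ = _ + X]big1 ?addr0 => [|A h]; last by rewrite koszul_ext0 ?mul0r.
  rewrite [RHS](reindex_omap (val : koszul_basis n i.+1 -> _) insub) => [|A hA].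
    apply: eq_big => [a|a _]; last by rewrite koszul_extE.
    by rewrite valK eqxx andbT; apply/esym/(valP a).
  by rewrite insubT.
under eq_bigr => A _ do rewrite mulr_sumr.
rewrite (exchange_big_dep predT) //= [RHS]big_mkcond /=.
apply: eq_bigr => k _; case: ifP => kb.
  rewrite (big_pred1 (k |: val b)) ?mulrA // => A /=.
  apply/andP/eqP => [[kA /eqP ->]|->]; first by rewrite setD1K.
  by rewrite setU11 setU1K.
apply: big1 => A /andP[kA /eqP h].
by rewrite h !inE eqxx in kb.
Qed.

Lemma setDD1 W B k : k \in W -> k \notin B -> W :\: ((W :\: B) :\ k) = k |: (W :&: B).
Proof.
move=> kW kB; apply/setP => l; rewrite !inE negb_and !negb_and !negbK.
by case: (eqVneq l k) => [->|] /=; rewrite ?kW // andbC; case: (l \in W); rewrite ?andbF ?orbF.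
Qed.

(** Removing [k] from a set adds it to the complement, so on complements the Koszul differential is
    a coboundary. The factor ['X_k] makes up for the lost basis index, which keeps the multidegree
    [M]. *)
Lemma mcoeff_free_map i (v : {ffun koszul_basis n i.+1 -> S}) M
    (b : koszul_basis n i) : val b \subset mnm_supp 0 M ->
  (free_map (@koszul_diff K n i) v b)@_(M - mesym1 (val b))%MM =
  coboundary (koszul_orientation (mnm_supp 0 M)) (koszul_part v M)
    (mnm_supp 0 M :\: val b).
Proof.
set W := mnm_supp 0 M => bW; rewrite free_map_koszul raddf_sum /=.
rewrite [RHS]big_mkcond [LHS]big_mkcond /=; apply: eq_bigr => k _.
rewrite mcoeff_mulX mnmBE mnmE inE.
case: (boolP (k \in val b)) => kb //=; rewrite subn0.
have -> : (k \in W) = (0 < M k)%N by rewrite inE.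
case: ifP => // Mk; have kW : k \in W by rewrite inE.
rewrite koszul_signE mulrC mcoeffCM /koszul_orientation /koszul_part -/W.
have -> : W :\: (W :\: val b :\ k) = k |: val b.
  by rewrite setDD1 // (setIidPr bW).
have -> : k |: (W :\: (W :\: val b)) = k |: val b by rewrite setDDr setDv set0U (setIidPr bW).
congr (_ * _@_ _); apply/mnmP => l; rewrite !(mnmBE, mnmE) !inE -subnDA.
rewrite [l == k]eq_sym; case: (eqVneq k l) => [<-|_]; first by rewrite (negbTE kb).
by rewrite addn0.
Qed.

End Koszul.

(** * Extrema of sets of naturals, and dimension zero *)

Lemma esup_max (A : set nat) m :
  A m -> (forall k, A k -> (k <= m)%N) -> esup A = (m%:Z)%:E.
Proof.
move=> Am mA; rewrite /esup /supremum; case: eqP => [E|_].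
  by have : [set (k%:Z)%:E | k in A]%classic (m%:Z)%:E; [exists m|rewrite E].
case: xgetP => [x -> [xub xlb]|/(_ (m%:Z)%:E)[]].
  apply/eqP; rewrite eq_le; apply/andP; split; last by apply: xub; exists m.
  by apply: xlb => _ [k Ak <-]; rewrite lee_fin lez_nat mA.
split; first by move=> _ [k Ak <-]; rewrite lee_fin lez_nat mA.
by move=> x; apply; exists m.
Qed.

Lemma esup_unbounded (A : set nat) :
  (forall k, exists2 m, A m & (k <= m)%N) -> esup A = +oo%E.
Proof.
move=> hA; have ub x : (forall m, A m -> (m%:Z)%:E <= x)%E -> x = +oo%E.
  case: x => [r| |] //= h; last by have [m /h] := hA 0%N.
  have [m /h] := hA `|r|.+1%N; rewrite lee_fin => mr rm; exfalso.
  by have := le_lt_trans (ler_norm r) (_ : `|r| < m%:Z); lia.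
rewrite /esup /supremum; case: eqP => [E|_].
  have [m Am _] := hA 0%N.
  by have : [set (k%:Z)%:E | k in A]%classic (m%:Z)%:E; [exists m|rewrite E].
case: xgetP => [x -> [xub _]|/(_ +oo%E)[]].
  by apply: ub => m Am; apply: xub; exists m.
split; first by move=> x _; apply: leey.
by move=> x xub; rewrite (ub x) // => m Am; apply: xub; exists m.
Qed.

Lemma einf_min (A : set nat) m :
  A m -> (forall k, A k -> (m <= k)%N) -> einf A = (m%:Z)%:E.
Proof.
move=> Am mA; rewrite /einf /infimum; case: eqP => [E|_].
  by have : [set (k%:Z)%:E | k in A]%classic (m%:Z)%:E; [exists m|rewrite E].
case: xgetP => [x -> [xlb xub]|/(_ (m%:Z)%:E)[]].
  apply/eqP; rewrite eq_le; apply/andP; split; first by apply: xlb; exists m.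
  by apply: xub => _ [k Ak <-]; rewrite lee_fin lez_nat mA.
split; first by move=> _ [k Ak <-]; rewrite lee_fin lez_nat mA.
by move=> x; apply; exists m.
Qed.

Lemma nat_has_min (A : set nat) m : A m ->
  exists2 k, A k & forall l, A l -> (k <= l)%N.
Proof.
move=> Am; have exA : exists k, `[< A k >] by exists m; apply/asboolP.
case: (ex_minnP exA) => k /asboolP Ak kA; exists k => // l Al.
exact/kA/asboolP.
Qed.

(** A single vector of [Z] outside [B] is already free modulo [B], since [B] is stable under
    scaling; if [Z] lies in [B], a unit coefficient vector refutes freeness of any non-empty
    family. *)
Lemma dim_quotient_eq0 (K : fieldType) (V : lmodType K) (Z B : set V) :
  (forall c v, B v -> B (c *: v)) ->
  dim_quotient Z B = 0%E <-> (forall v, Z v -> B v).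
Proof.
move=> BZ; split=> [dim0 v Zv|ZB]; last first.
  rewrite /dim_quotient (@esup_max _ 0%N) //; first by exists (fun=> 0) => [[]|? ? []].
  move=> [//|m] [v Zv /(_ (fun i => (i == ord0)%:R)) fv]; exfalso.
  have /fv/(_ ord0) : B (\sum_(i < m.+1) (i == ord0)%:R *: v i).
    rewrite (bigD1 ord0) //= scale1r big1 ?addr0; first exact: ZB.
    by move=> i /negbTE ->; rewrite scale0r.
  by move=> /eqP; rewrite eqxx oner_eq0.
apply: contrapT => nBv; move: dim0; rewrite /dim_quotient.
set A := [set m | _]%classic; have A1 : A 1%N.
  exists (fun=> v) => // c; rewrite big_ord1 => Bcv i; rewrite (ord1 i).
  apply/eqP; apply: contra_notT nBv => c0.
  by have := BZ (c ord0)^-1 _ Bcv; rewrite scalerA mulVf // scale1r.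
(* The set of sizes contains 1: its supremum is infinite or a maximum that is at least 1, so never
   0. *)
have [[k kA]|unb] := pselect (exists k, forall m, A m -> (m <= k)%N); last first.
  rewrite esup_unbounded // => k; apply: contrapT => h; apply: unb; exists k => m Am.
  by rewrite leqNgt; apply/negP => /ltnW km; apply: h; exists m.
have exA : exists k, `[< A k >] by exists 1%N; apply/asboolP.
have kA' m : `[< A m >] -> (m <= k)%N by move=> /asboolP; apply: kA.
case: (ex_maxnP exA kA') => m /asboolP Am mA.
rewrite (esup_max Am); last by move=> l Al; apply/mA/asboolP.
by move=> [m0]; have := mA 1%N (asboolT A1); rewrite m0.
Qed.

(** * Edge ideals and the vanishing of their Betti numbers *)

Section EdgeIdeal.
Variables (K : fieldType) (n : nat) (e : rel 'I_n).
Local Notation S := {mpoly K[n]}.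
Local Notation I := (edge_ideal K (graph_compl e)).
Local Notation cycles i j := (@tensor_cycles K n (koszul K n) I i j).
Local Notation boundaries i j := (@tensor_boundaries K n (koszul K n) I i j).
Implicit Types (F H : {set 'I_n}) (M m : 'X_{1..n}) (f : S).

Lemma cliqueNP F : reflect (exists i j, [/\ i \in F, j \in F & graph_compl e i j])
  (~~ clique e F).
Proof.
apply: (iffP idP) => [|[i [j [iF jF /andP[ij nij]]]]]; last first.
  by apply: contra nij => /cliqueP; apply.
rewrite negb_forall_in => /exists_inP[i iF]; rewrite negb_forall_in.
move=> /exists_inP[j jF]; rewrite negb_imply => ij.
by exists i, j.
Qed.

Lemma edge_ideal_sum (r : rel 'I_n) (A : eqType) (a : seq A) (F : A -> S) :
  {in a, forall x, edge_ideal K r (F x)} -> edge_ideal K r (\sum_(x <- a) F x).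
Proof.
move=> h; rewrite big_seq; elim/big_ind: _ => [|f g [c ->] [d ->]|x /h //].
  by exists (fun _ _ => 0); rewrite big1 // => i _; rewrite big1 // => j _; rewrite mul0r.
exists (fun i j => c i j + d i j); rewrite -big_split; apply: eq_bigr => i _ /=.
by rewrite -big_split; apply: eq_bigr => j _; rewrite mulrDl.
Qed.

(** The ideal is monomial, and a monomial is divisible by a generator exactly when its support
    contains a non-edge of the graph. *)
Lemma edge_ideal_complP f :
  I f <-> (forall m, m \in msupp f -> ~~ clique e (mnm_supp 0 m)).
Proof.
split=> [[c ->] m|h].
  apply: contraTN => /cliqueP cl; rewrite -mcoeff_eq0; apply/eqP.
  rewrite raddf_sum big1 //= => i _; rewrite raddf_sum big1 //= => j /andP[ij nij].
  rewrite mulrA !mcoeff_mulX mnmBE mnm1E [j == i]eq_sym (negbTE ij) subn0.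
  case: ifP => // mj; case: ifP => // mi.
  by have := cl i j; rewrite !inE mi mj (negbTE nij) => /(_ isT isT ij).
rewrite [f]mpolyE; apply: edge_ideal_sum => m /h /cliqueNP[i [j [im jm ij]]].
exists (fun k l => if (k == i) && (l == j) then f@_m *: 'X_[m - U_(j) - U_(i)] else 0).
rewrite (bigD1 i) //= (bigD1 j) //= !eqxx /= !big1 ?addr0.
- rewrite -scalerAl -!mpolyXD addmA !submK //.
    by rewrite lep1mP -lt0n; rewrite inE in jm.
  rewrite lep1mP -lt0n mnmBE mnm1E; case/andP: ij => ij _.
  by rewrite eq_sym (negbTE ij) subn0; rewrite inE in im.
- by move=> k /negbTE ->; rewrite big1 // => l _; rewrite mul0r.
- by move=> l /andP[_ /negbTE ->]; rewrite mul0r.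
Qed.

Lemma edge_idealZ c f : I f -> I (c *: f).
Proof. by move=> /edge_ideal_complP h; apply/edge_ideal_complP => m /msuppZ_le/h. Qed.

Lemma homog_shiftD i j f : homog_shift i (i + j) f = (f \is j.-homog).
Proof. by rewrite /homog_shift leq_addr addKn. Qed.

Lemma free_mapZ (A B : finType) (d : A -> B -> S) c (v : {ffun A -> S}) :
  free_map d (c *: v) = c *: free_map d v.
Proof.
apply/ffunP => b; rewrite !ffunE scaler_sumr; apply: eq_bigr => a _.
by rewrite ffunE scalerAl.
Qed.

Lemma free_mapB (A B : finType) (d : A -> B -> S) (v w : {ffun A -> S}) :
  free_map d (v - w) = free_map d v - free_map d w.
Proof.
apply/ffunP => b; rewrite !ffunE -sumrB; apply: eq_bigr => a _.
by rewrite !ffunE mulrBl.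
Qed.

Lemma betti_eq0 i j : betti I i j = 0%E <->
  (forall v, cycles i j v -> boundaries i j v).
Proof.
apply: dim_quotient_eq0 => c _ [w Iw <-]; exists (c *: w); last exact: free_mapZ.
move=> b; rewrite ffunE; have [Iwb hwb] := Iw b; split; first exact: edge_idealZ.
move: hwb; rewrite /homog_shift; case: ifP => _; first exact: rpredZ.
by move=> /eqP ->; rewrite scaler0.
Qed.

(** Variables of exponent at least 2 survive the division; they become the set [W2] of
    [relative_clique_cohomology]. *)
Lemma mnm_supp_sub M F : F \subset mnm_supp 0 M ->
  mnm_supp 0 (M - mesym1 (mnm_supp 0 M :\: F))%MM = F :|: mnm_supp 1 M.
Proof.
move=> /fintype.subsetP FM; apply/setP => k; rewrite !inE mnmBE mnmE !inE.
case: (boolP (k \in F)) => [/FM|] /=; first by rewrite inE subn0.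
by case: (M k) => [|[|m]].
Qed.

Lemma mnm_suppDl m F : F \subset mnm_supp 0 (m + mesym1 F)%MM.
Proof.
by apply/fintype.subsetP => k kF; rewrite inE mnmDE mnmE kF addn1.
Qed.

Lemma card_mnm_supp M : mnm_supp 1 M = finset.set0 -> #|mnm_supp 0 M| = mdeg M.
Proof.
move=> M1; rewrite -sum1_card mdegE [RHS](bigID (mem (mnm_supp 0 M))) /=.
rewrite [X in _ = (_ + X)%N]big1 => [|k]; last by rewrite inE -eqn0Ngt => /eqP.
rewrite addn0; apply: eq_bigr => k; rewrite inE => Mk; apply/eqP.
by rewrite eqn_leq Mk leqNgt; move/setP: M1 => /(_ k); rewrite !inE => ->.
Qed.

Lemma mdegBmesym1 M F : F \subset mnm_supp 0 M ->
  (mdeg (M - mesym1 F) + #|F|)%N = mdeg M.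
Proof.
move=> /fintype.subsetP FM; rewrite -mdeg_mesym1 -mdegD submK //.
apply/mnm_lepP => k; rewrite mnmE; case: (boolP (k \in F)) => // /FM.
by rewrite inE.
Qed.

Lemma mcoeff_sum_bounded (E : 'X_{1..n} -> K) k m :
  (\sum_(m' : 'X_{1..n < k}) (E m' *: 'X_[m']) : S)@_m =
  if (mdeg m < k)%N then E m else 0.
Proof.
case: ifPn => km; first exact: mcoeff_mpoly.
rewrite raddf_sum big1 //= => m' _; rewrite mcoeffZ mcoeffX.
by case: eqP => [E'|]; rewrite ?mulr0 //; rewrite -E' bmdeg in km.
Qed.

Hypotheses (e_sym : ssrbool.symmetric e) (e_irr : irreflexive e).

(** The coefficients in multidegree [M] of a Koszul preimage of [v]: the first clause places it over
    the ideal, the second makes it map to [v]. *)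
Definition part_solution i (v : {ffun koszul_basis n i -> S}) M
    (g : {set 'I_n} -> K) : Prop :=
  (forall H, H \subset mnm_supp 0 M -> clique e (H :|: mnm_supp 1 M) ->
     #|H|.+1 = (#|mnm_supp 0 M| - i)%N -> g H = 0) /\
  (forall F, F \subset mnm_supp 0 M -> #|F| = (#|mnm_supp 0 M| - i)%N ->
     coboundary (koszul_orientation K (mnm_supp 0 M)) g F = koszul_part v M F).

Lemma koszul_part_acyclic p i j (v : {ffun koszul_basis n i -> S}) M :
  (i < p)%N -> (2 < j)%N ->
  (forall C, induced_cycle e C -> (3 < #|C|)%N -> (p + 3 <= #|C|)%N) ->
  cycles i (i + j) v -> mdeg M = (i + j)%N ->
  exists g, part_solution v M g.
Proof.
move=> ip j2 noC [vI vker] Mij; set W := mnm_supp 0 M.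
have cD F : F \subset W -> #|W :\: F| = (#|W| - #|F|)%N by move=> FW; rewrite cardsD (setIidPr FW).
apply: (relative_clique_cohomology e_sym e_irr (p := p)) => //.
- exact: orientation_koszul.
- by apply/fintype.subsetP => k; rewrite !inE => /ltnW.
(* For squarefree [M] the support has [i + j] elements, so the cardinality [#|W| - i] is [j]. *)
- by move=> /card_mnm_supp; rewrite -/W Mij => ->; rewrite addKn ltn_add2r.
- move=> F FW cF _; rewrite /koszul_part -/W; apply: memN_msupp_eq0.
  apply: contraL cF; rewrite -(mnm_supp_sub FW).
  case: (boolP (#|W :\: F| == i)) => [h|/koszul_ext0 ->]; last by rewrite msupp0.
  rewrite koszul_ext_elt.
  by have [/edge_ideal_complP hI _] := vI (koszul_elt h); apply: hI.
(* When [i] exceeds [#|W|] the difference truncates to 0, but then [W] has no subset of [i] elements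
   and [koszul_part] is 0. *)
- move=> F FW Fj; case: (leqP i #|W|) => iW; last first.
    rewrite /coboundary big1 // => k kF; rewrite /koszul_part koszul_ext0 ?mcoeff0 ?mulr0 //.
    by rewrite -/W neq_ltn (leq_ltn_trans (subset_leq_card (subsetDl _ _)) iW).
  case: i v ip Mij vI vker Fj iW => [|i] v ip Mij vI vker Fj iW.
    by have := subset_leq_card FW; rewrite Fj subn0 ltnn.
  have h : #|W :\: F| == i by rewrite cD // Fj subnS subKn.
  have FE : F = W :\: (W :\: F) by rewrite setDDr setDv set0U (setIidPr FW).
  have := mcoeff_free_map v (M := M) (b := koszul_elt h) (subsetDl _ _).
  by rewrite [free_map _ _]vker ffunE mcoeff0 /= -/W -FE.
Qed.

(** The solutions for the separate multidegrees are glued into one vector [w]. A monomial [m] at a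
    basis set of [i.+1] elements has total degree [i + j] exactly when [mdeg m] is [j.-1]. *)
Lemma tensor_cycles_boundaries p i j (v : {ffun koszul_basis n i -> S}) :
  (i < p)%N -> (2 < j)%N ->
  (forall C, induced_cycle e C -> (3 < #|C|)%N -> (p + 3 <= #|C|)%N) ->
  cycles i (i + j) v ->
  boundaries i (i + j) v.
Proof.
move=> ip j2 noC vc; have [vI _] := vc; have j0 : (0 < j)%N by apply: ltn_trans j2.
(* The degree condition sits under the existential so that one solution can be chosen for every
   [M]. *)
have ex M : exists g, mdeg M = (i + j)%N -> part_solution v M g.
  have [Mij|nMij] := pselect (mdeg M = (i + j)%N); last by exists (fun=> 0).
  by have [g hg] := koszul_part_acyclic ip j2 noC vc Mij; exists g.
have [g hg] := boolp.choice ex.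
pose w : {ffun koszul_basis n i.+1 -> S} := [ffun a : koszul_basis n i.+1 =>
  \sum_(m : 'X_{1..n < j}) (if mdeg m == j.-1 then
      g (m + mesym1 (val a))%MM (mnm_supp 0 (m + mesym1 (val a))%MM :\: val a)
    else 0) *: 'X_[m]].
have wE (a : koszul_basis n i.+1) m : (w a)@_m = if mdeg m == j.-1 then
      g (m + mesym1 (val a))%MM (mnm_supp 0 (m + mesym1 (val a))%MM :\: val a)
    else 0.
  rewrite ffunE (mcoeff_sum_bounded (fun m => if mdeg m == j.-1 then
      g (m + mesym1 (val a))%MM (mnm_supp 0 (m + mesym1 (val a))%MM :\: val a)
    else 0)); case: eqP => [->|_]; last by rewrite if_same.
  by rewrite ltn_predL j0.
exists w.
  move=> a; have ai : #|val a| = i.+1 by apply/eqP/(valP a).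
  split; last first.
    have -> : (i + j)%N = (i.+1 + j.-1)%N by rewrite addSnnS prednK.
    rewrite [homog_shift _ _ _](homog_shiftD i.+1 j.-1 (w a)).
    apply/dhomogP => m; rewrite mcoeff_msupp wE.
    by have [//|_] := eqVneq (mdeg m) j.-1; rewrite eqxx.
  apply/edge_ideal_complP => m; rewrite mcoeff_msupp wE.
  have [mj|_] := eqVneq (mdeg m) j.-1; last by rewrite eqxx.
  apply: contraNN => cl; set M := (m + _)%MM; set W := mnm_supp 0 M.
  have aW : val a \subset W by apply: mnm_suppDl.
  have Mij : mdeg M = (i + j)%N by rewrite mdegD mdeg_mesym1 ai mj; lia.
  have [g0 _] := hg M Mij; apply/eqP/g0; first exact: subsetDl.
    rewrite -mnm_supp_sub ?subsetDl // -/W setDDr setDv set0U (setIidPr aW).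
    by rewrite addmK.
  by rewrite cardsD (setIidPr aW) ai -/W; have := subset_leq_card aW; lia.
apply/ffunP => b; apply/mpolyP => m.
have bi : #|val b| = i by apply/eqP/(valP b).
set M := (m + mesym1 (val b))%MM; set W := mnm_supp 0 M.
have bW : val b \subset W by apply: mnm_suppDl.
have mE : m = (M - mesym1 (val b))%MM by rewrite addmK.
have WbE : W :\: (W :\: val b) = val b by rewrite setDDr setDv set0U (setIidPr bW).
rewrite {1}mE [LHS](mcoeff_free_map w (M := M)) //.
have part k : k \in W :\: val b -> koszul_part w M ((W :\: val b) :\ k) =
    if mdeg m == j then g M ((W :\: val b) :\ k) else 0.
  rewrite inE => /andP[kb kW]; rewrite /koszul_part -/W setDD1 // (setIidPr bW).
  have h : #|k |: val b| == i.+1 by rewrite cardsU1 kb bi.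
  have kbW : k |: val b \subset W by rewrite subUset sub1set kW.
  rewrite koszul_ext_elt wE /= submK; last first.
    by apply/mnm_lepP => l; rewrite mnmE; case: (boolP (l \in _)) => // /(subsetP kbW); rewrite inE.
  have := mdegBmesym1 kbW; rewrite (eqP h) mdegD mdeg_mesym1 bi => dE.
  have -> : (mdeg (M - mesym1 (k |: val b)) == j.-1) = (mdeg m == j) by lia.
  by rewrite setUC setDDl.
(* Off degree [j] both sides vanish, the right one because [v] is homogeneous. *)
case: (eqVneq (mdeg m) j) part => [mj|mj] part; last first.
  rewrite /coboundary big1 => [|k /part ->]; last by rewrite mulr0.
  apply/esym/memN_msupp_eq0/negP => mv; have [_] := vI b.
  by rewrite homog_shiftD => /dhomogP/(_ _ mv)/eqP; apply/negP.
have Mij : mdeg M = (i + j)%N by rewrite mdegD mdeg_mesym1 bi mj addnC.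
have [_ gE] := hg M Mij.
rewrite (eq_coboundary _ part) gE ?subsetDl //; last by rewrite cardsD (setIidPr bW) bi.
by rewrite /koszul_part -/W WbE koszul_extE -mE.
Qed.

End EdgeIdeal.

(** * The homology class of an induced cycle *)

Section CycleClass.
Variables (K : fieldType) (n : nat) (e : rel 'I_n).
Local Notation S := {mpoly K[n]}.
Local Notation I := (edge_ideal K (graph_compl e)).
Implicit Types (A F : {set 'I_n}) (m : 'X_{1..n}).
Hypothesis e_sym : ssrbool.symmetric e.
Variables (C : {set 'I_n}) (x : 'I_n) (p : seq 'I_n).
Hypotheses (uniq_xp : uniq (x :: p)) (p_gt2 : (2 < size p)%N) (CE : C =i x :: p)
  (eE : {in C &, forall u v, e u v = (v == next (x :: p) u) || (u == next (x :: p) v)}).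

Let c i : 'I_n := nth x (x :: p) i.

Let c_in i : (i <= size p)%N -> c i \in C.
Proof. by move=> ip; rewrite CE mem_nth. Qed.

Let c_inj i j : (i <= size p)%N -> (j <= size p)%N -> (c i == c j) = (i == j).
Proof. by move=> ip jp; rewrite /c nth_uniq. Qed.

Let cP k : k \in C -> exists2 i, (i <= size p)%N & k = c i.
Proof. by rewrite CE => /(nthP x)[i ip <-]; exists i. Qed.

Let next_c i : (i < size p)%N -> next (x :: p) (c i) = c i.+1.
Proof.
by move=> ip; rewrite next_nth mem_nth ?index_uniq //= ltnS ltnW.
Qed.

Let next_last : next (x :: p) (c (size p)) = c 0.
Proof. by rewrite next_nth mem_nth ?index_uniq //= nth_default. Qed.

Let F0 := [set c 0; c (size p)].

Let F0C : F0 \subset C.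
Proof. by rewrite subUset !sub1set !c_in. Qed.

Let cardF0 : #|F0| = 2.
Proof. by rewrite cards2 c_inj //; case: (size p) p_gt2. Qed.

Let cardC : #|C| = (size p).+1.
Proof. by rewrite (eq_card CE) (card_uniqP uniq_xp). Qed.

(** A common neighbour of both ends of [F0] would be [c 1] and also precede [c (size p)], forcing a
    cycle of length 3. This is what places [z] over the ideal. *)
Let F0_triangle_free k : k \in C -> k \notin F0 -> ~~ clique e (k |: F0).
Proof.
move=> kC kF0; apply/negP => /cliqueP cl; have [i ip kE] := cP kC.
move: kF0; rewrite !inE kE !c_inj // => /norP[i0 ine].
have ip' : (i < size p)%N by rewrite ltn_neqAle ine.
have p1 : (1 <= size p)%N by apply: leq_trans p_gt2.
have : e (c 0) k by apply: cl; rewrite ?inE ?eqxx ?orbT // kE c_inj // eq_sym.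
rewrite eE ?c_in // kE !next_c // !c_inj // => /orP[/eqP i1|//].
have : e (c (size p)) k.
  by apply: cl; rewrite ?inE ?eqxx ?orbT // kE c_inj // eq_sym.
rewrite eE ?c_in // kE next_last next_c // !c_inj // (negbTE i0) /= i1.
by move=> /eqP E; move: p_gt2; rewrite E.
Qed.

Let M := mesym1 C.

Let suppM : mnm_supp 0 M = C.
Proof. by apply/setP => k; rewrite inE mnmE; case: (k \in C). Qed.

Let MB F : F \subset C -> (M - mesym1 (C :\: F))%MM = mesym1 F.
Proof.
move=> /fintype.subsetP FC; apply/mnmP => k; rewrite mnmBE !mnmE inE.
by case: (boolP (k \in F)) => [/FC ->|_] //=; case: (k \in C).
Qed.

Let CDD F : F \subset C -> C :\: (C :\: F) = F.
Proof. by move=> FC; rewrite setDDr setDv set0U (setIidPr FC). Qed.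

(** Here [i] is [#|C| - 3], written as a successor so that [koszul_exactS] applies at [i0]. *)
Let i0 := (size p - 3)%N.
Let i := i0.+1.

Let card_pairC F : F \subset C -> #|F| = 2 -> #|C :\: F| == i.+1.
Proof. by move=> FC F2; rewrite cardsD (setIidPr FC) F2 cardC /i /i0; lia. Qed.

(* u is the indicator of the edge F0 of the cycle.  Its Koszul image z lies in I; *)
(* if z were a boundary over I, that indicator would be, along the cycle, the     *)
(* coboundary of a function on the vertices, whose sum around the cycle is 0.     *)
Let u : {ffun koszul_basis n i.+1 -> S} :=
  [ffun a => if val a == C :\: F0 then 'X_[mesym1 F0] else 0].

Let z : {ffun koszul_basis n i -> S} := free_map (@koszul_diff K n i) u.

Let koszul_ext_u A : koszul_ext u A = if A == C :\: F0 then 'X_[mesym1 F0] else 0.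
Proof.
have [h|h] := boolP (#|A| == i.+1); first by rewrite koszul_ext_elt ffunE.
rewrite koszul_ext0 //; case: eqP => // E.
by rewrite E (card_pairC F0C) in h.
Qed.

Let z_supp b m : m \in msupp (z b) ->
  exists k, [/\ k \in C, k \notin F0 & m = (mesym1 F0 + U_(k))%MM].
Proof.
move=> mz; apply: contrapT => nk; move: mz; rewrite mcoeff_msupp => /eqP; apply.
rewrite [z b]free_map_koszul raddf_sum big1 //= => k kb.
rewrite mcoeff_mulX; case: ifP => // mk.
rewrite koszul_signE mulrC mcoeffCM koszul_ext_u; case: eqP => [E|_]; last first.
  by rewrite mcoeff0 mulr0.
rewrite mcoeffX; case: eqP => [Em|_]; last by rewrite mulr0.
case: nk; exists k; have : k \in C :\: F0 by rewrite -E setU11.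
rewrite in_setD => /andP[-> ->]; split=> //.
by rewrite Em submK // lep1mP -lt0n.
Qed.

Let z_cycle : @tensor_cycles K n (koszul K n) I i (i + 3) z.
Proof.
split; last first.
  by have /(_ z)[_] := @koszul_exactS K n i0; apply; exists u.
move=> b; split.
  apply/edge_ideal_complP => m /z_supp[k [kC kF0 ->]].
  have -> : mnm_supp 0 (mesym1 F0 + U_(k)) = k |: F0; last exact: F0_triangle_free.
  apply/setP => l; rewrite in_setU1 [LHS]inE mnmDE mnmE mnm1E eq_sym.
  by case: eqP => //; case: (l \in F0).
rewrite [homog_shift _ _ _](homog_shiftD i 3 (z b)).
apply/dhomogP => m /z_supp[k [_ _ ->]].
by rewrite -[LHS]/(mdeg _) mdegD mdeg1 mdeg_mesym1 cardF0.
Qed.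

Let z_not_boundary : ~ @tensor_boundaries K n (koszul K n) I i (i + 3) z.
Proof.
move=> [w wI wz].
(* Over the whole ring [u - w] is a cycle, hence the image of some [y]. *)
have /(_ (u - w))[+ _] := @koszul_exactS K n i.
rewrite free_mapB [X in _ - X]wz subrr => /(_ erefl)[y yE].
have yF F : F \subset C -> #|F| = 2 -> clique e F ->
    coboundary (koszul_orientation K C) (koszul_part y M) F = (F == F0)%:R.
  move=> FC F2 cF; have h := card_pairC FC F2.
  have := mcoeff_free_map y (M := M) (b := koszul_elt h).
  rewrite suppM => /(_ (subsetDl _ _)); rewrite -yE !ffunE mcoeffB /=.
  rewrite MB // CDD // => <-.
  have -> : (C :\: F == C :\: F0) = (F == F0).
    by apply/eqP/eqP => [E|->//]; rewrite -(CDD FC) E CDD.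
  rewrite [X in _ - X](_ : _ = 0).
    by rewrite subr0; case: eqP => [->|]; rewrite ?mcoeffX ?eqxx ?mcoeff0.
  (* [w] does not contribute on a clique [F], because the monomial of [F] is not in the ideal. *)
  apply: memN_msupp_eq0; apply: contraL cF => wF.
  have [/edge_ideal_complP/(_ _ wF)] := wI (koszul_elt h).
  suff -> : mnm_supp 0 (mesym1 F) = F by [].
  by apply/setP => l; rewrite inE mnmE; case: (l \in F).
have sC := orientation_koszul K C.
pose g k := koszul_orientation K C k [set k] * koszul_part y M [set k].
have clique2 a b : e a b -> clique e [set a; b].
  move=> ab; apply/cliqueP => k l /set2P[->|->] /set2P[->|->]; rewrite ?eqxx //.
  by rewrite e_sym.
have nz k F : F \subset C -> k \in F -> (koszul_orientation K C k F == 0) = false.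
  move=> FC kF; have := sC.1 k F FC kF; case: eqP => // ->.
  by rewrite mul0r => /esym/eqP; rewrite oner_eq0.
have sum2 a b : a \in C -> b \in C -> a != b -> e a b ->
    (g b - g a == 0) = ([set a; b] != F0).
  move=> aC bC ab eab; have FC : [set a; b] \subset C by rewrite subUset !sub1set aC.
  have F2 : #|[set a; b]| = 2 by rewrite cards2 ab.
  have := yF _ FC F2 (clique2 a b eab).
  rewrite (coboundary_pair_scaled _ sC FC F2 (set21 _ _) (set22 _ _) ab).
  rewrite -/(g a) -/(g b) => E; have := congr1 (fun t => t == 0) E.
  rewrite /= mulf_eq0 mulf_eq0 !nz ?set21 ?set11 ?sub1set //= => ->.
  by case: (_ == F0); rewrite ?oner_eq0 ?eqxx.
(* [g] is constant along the path from [c 0] to [c (size p)] that avoids [F0], yet it has to jump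
   across [F0]. *)
have gE j : (j <= size p)%N -> g (c j) = g (c 0).
  elim: j => // j IH jp; rewrite -IH; last exact: ltnW.
  apply/eqP; rewrite -subr_eq0 sum2 ?c_in ?(ltnW jp) //.
  - apply/negP => /eqP E; have : c j \in F0 by rewrite -E set21.
    have : c j.+1 \in F0 by rewrite -E set22.
    rewrite !inE !c_inj ?(ltnW jp) //= => /eqP j1 /orP[/eqP j0|/eqP jE].
      by move: p_gt2; rewrite -j1 j0.
    by move: jp; rewrite jE ltnn.
  - by rewrite c_inj ?(ltnW jp) // ltn_eqF.
  - by rewrite eE ?c_in ?(ltnW jp) // next_c // eqxx.
have := sum2 (c 0) (c (size p)) (c_in (leq0n _)) (c_in (leqnn _)).
rewrite gE // subrr !eqxx; case: (boolP (c 0 == c (size p))).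
  by rewrite c_inj // => /eqP E; move: p_gt2; rewrite -E.
move=> _ /(_ isT); rewrite eE ?c_in // next_last eqxx orbT.
by move=> /(_ isT).
Qed.

Lemma betti_cycle_neq0 : betti I (#|C| - 3) (#|C| - 3 + 3) <> 0%E.
Proof.
have -> : (#|C| - 3)%N = i by rewrite cardC /i /i0; lia.
by move=> /betti_eq0/(_ _ z_cycle)/z_not_boundary.
Qed.

End CycleClass.

(** * The equivalence and the index *)

Lemma satisfies_N_cycles (K : fieldType) (n : nat) (e : rel 'I_n)
    (e_sym : ssrbool.symmetric e) (e_irr : irreflexive e) (p : nat) :
  satisfies_N (edge_ideal K (graph_compl e)) 2 p <->
  (forall C : {set 'I_n}, induced_cycle e C -> (3 < #|C|)%N -> (p + 3 <= #|C|)%N).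
Proof.
split=> [Np C [s [us s2 Cs eC]] C3|noC i j ip j2]; last first.
  by apply/betti_eq0 => v; apply: tensor_cycles_boundaries noC.
rewrite leqNgt; apply/negP => Cp.
case: s => [//|x s] in us s2 Cs eC *.
have s3 : (2 < size s)%N.
  by move: C3; rewrite (eq_card Cs) (card_uniqP us).
(* A cycle that is too short violates [Np] at [i = #|C| - 3] and [j = 3]. *)
apply: (betti_cycle_neq0 (K := K) e_sym us s3 Cs eC); apply: Np => //.
by lia.
Qed.

(** Every monomial of the ideal involves two distinct variables, and a non-zero element exhibits a
    non-edge whose monomial has degree 2. *)
Lemma indeg_edge_ideal (K : fieldType) (n : nat) (e : rel 'I_n) :
  edge_ideal K (graph_compl e) <> [set 0]%classic ->
  indeg (edge_ideal K (graph_compl e)) = (2%:Z)%:E.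
Proof.
set I := edge_ideal _ _ => I_neq0.
have [f If f0] : exists2 f, I f & f != 0.
  apply: contrapT => nf; apply: I_neq0; apply/seteqP; split=> f /=.
    by move=> If; apply/eqP; apply: contra_notT nf => f0; exists f.
  by move=> ->; apply/edge_ideal_complP => m; rewrite msupp0.
have msupp_mem (g : {mpoly K[n]}) : g != 0 -> exists m, m \in msupp g.
  by move=> g0; exists (mlead g); apply: mlead_supp.
apply: einf_min.
  have [m mf] := msupp_mem f f0.
  have /edge_ideal_complP/(_ m mf)/cliqueNP[i [j [_ _ ij]]] := If.
  have ij' : i != j by have /andP[] := ij.
  exists 'X_[U_(i) + U_(j)]; last first.
    by rewrite dhomogX /= -msupp_eq0 msuppX; split=> //; apply/eqP; rewrite -[LHS]/(mdeg _) mdegD !mdeg1.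
  apply/edge_ideal_complP => m'; rewrite msuppX inE => /eqP ->.
  apply/cliqueNP; exists i, j; split=> //; rewrite inE mnmDE !mnm1E eqxx //.
  by rewrite addn1.
move=> d [g /edge_ideal_complP Ig [gd g0]]; have [m mg] := msupp_mem g g0.
have /cliqueNP[i [j [im jm /andP[ij _]]]] := Ig m mg.
have /dhomogP/(_ m mg) <- := gd; rewrite -[X in (_ <= X)%N]/(mdeg m) mdegE.
rewrite !inE in im jm; rewrite (bigD1 i) //= (bigD1 j) 1?eq_sym //= addnA.
exact: leq_trans (leq_add im jm) (leq_addr _ _).
Qed.

Theorem theorem3p3 (K : fieldType) (n : nat) (e : rel 'I_n)
    (e_sym : ssrbool.symmetric e) (e_irr : irreflexive e)
    (I_neq0 : edge_ideal K (graph_compl e) <> [set 0]%classic) :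
  (forall p : nat, (0 < p)%N ->
     satisfies_N (edge_ideal K (graph_compl e)) 2 p <->
     (forall C : {set 'I_n}, induced_cycle e C -> (3 < #|C|)%N ->
        (p + 3 <= #|C|)%N)) /\
  gl_index (edge_ideal K (graph_compl e)) =
    einf [set (#|C| - 3)%N | C in
            [set C : {set 'I_n} | induced_cycle e C /\ (3 < #|C|)%N]]%classic.
Proof.
split=> [p _|]; first exact: satisfies_N_cycles.
rewrite /gl_index (indeg_edge_ideal I_neq0).
set A := [set p | _]%classic; set B := [set _ | _ in _]%classic.
have AE p : (0 < p)%N -> (forall b, B b -> (p <= b)%N) -> A p.
  move=> p0 pB; split=> //; exists 2 => //; apply/satisfies_N_cycles => // C iC C3.
  by have := pB (#|C| - 3)%N; rewrite /B => /(_ (ex_intro2 _ _ C (conj iC C3) erefl)); lia.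
have AB p b : A p -> B b -> (p <= b)%N.
  move=> [_ [d [<-] Np]] [C [iC C3] <-].
  by have /satisfies_N_cycles := Np; move=> /(_ e_sym e_irr C iC C3); lia.
(* Without long induced cycles every positive [p] is in [A], and the infimum takes its default value
   [+oo]. *)
have [[b Bb]|nB] := pselect (exists b, B b); last first.
  rewrite esup_unbounded => [|k]; last first.
    by exists k.+1 => //; apply: AE => // b Bb; case: nB; exists b.
  rewrite /einf /infimum ifT //; apply/eqP/seteqP; split=> // y [b Bb _].
  by case: nB; exists b.
have [m Bm mB] := nat_has_min Bb.
rewrite (einf_min Bm mB); apply: esup_max => [|p Ap]; last exact: AB.
(* The minimum itself belongs to [A]: it is positive because [#|C|] exceeds 3. *)
apply: AE mB; have [C [_ C3] <-] := Bm; lia.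
Qed.
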